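(* Let $\psi(x)=-2\pi\sin(2\pi x)$, $b\ge2$ an integer and $\gamma\in(1/b,1)$. Then: (1) if $b\ge6$, then $\sigma(1)\le e(1)<\gamma b$; (2) if $b\in\{4,5\}$, then either $e(1)=2$ or $e(1)<\gamma b$; (3) if $b=3$, then either $e(1)=2$ or $\sigma(1)<\gamma b$.
   Context: $\mathcal{A}=\{0,\dots,b-1\}$. $S(x,\mathbf{i})=\sum_{n\ge1}\gamma^{n-1}\psi\big(\frac{x+i_1+i_2b+\cdots+i_nb^{n-1}}{b^n}\big)$ for $\mathbf{i}\in\mathcal{A}^{\mathbb{Z}^+}$, $S'=\partial_xS$. For $\mathbf{u}\in\mathcal{A}^q$, $x(\mathbf{u})=(x+u_1+\cdots+u_qb^{q-1})/b^q$. Sequences $\mathbf{i},\mathbf{j}$ are $(\varepsilon,\delta)$-tangent at $x_0$ if $|S(x_0,\mathbf{i})-S(x_0,\mathbf{j})|\le\varepsilon$ and $|S'(x_0,\mathbf{i})-S'(x_0,\mathbf{j})|\le\delta$. $E(q,x_0;\varepsilon,\delta)$: pairs $(\mathbf{k},\mathbf{l})\in\mathcal{A}^q\times\mathcal{A}^q$ such that some concatenations $\mathbf{ku},\mathbf{lv}$ are $(\varepsilon,\delta)$-tangent at $x_0$. For $J\subset\mathbb{R}$: $E(q,J)=\bigcap_{\varepsilon,\delta>0}\bigcup_{x\in J}E(q,x;\varepsilon,\delta)$, $e(q,J)=\max_{\mathbf{k}}\#\{\mathbf{l}:(\mathbf{k},\mathbf{l})\in E(q,J)\}$, and $e(q)=\lim_{p\to\infty}\max_{0\le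 k<b^p}e(q,[k/b^p,(k+1)/b^p])$. Weight function: measurable $\omega:[0,1)\to(0,\infty)$ with $\omega,1/\omega$ bounded. Admissible testing function of order $q$: measurable $V:[0,1)\times\mathcal{A}^q\times\mathcal{A}^q\to[0,\infty)$ such that for some $\varepsilon,\delta>0$, $V(x,\mathbf{u},\mathbf{v})V(x,\mathbf{v},\mathbf{u})\ge1$ whenever $x\in[0,1)$ and $(\mathbf{u},\mathbf{v})\in E(q,x;\varepsilon,\delta)$. $\Sigma_{V,\omega}(x)=\sup_{\mathbf{u}}\frac{\omega(x)}{\omega(x(\mathbf{u}))}\sum_{\mathbf{v}}V(x,\mathbf{u},\mathbf{v})$; $\sigma(q)=\inf_{\omega,V}\|\Sigma_{V,\omega}\|_\infty$. *)

(* Defs.v *)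
From Stdlib Require Import Reals Lra Lia Arith ClassicalEpsilon.
Open Scope R_scope.

Definition psi (y : R) : R := - (2 * PI) * sin (2 * PI * y).

(** limit of a real sequence (chosen classically; meaningful when it exists) *)
Definition lim (u : nat -> R) : R := epsilon (inhabits 0) (fun l => Un_cv u l).

Fixpoint rsum (n : nat) (f : nat -> R) : R :=
  match n with O => 0 | S m => rsum m f + f m end.
Fixpoint rmax (n : nat) (f : nat -> R) : R :=
  match n with O => 0 | S O => f O | S m => Rmax (rmax m f) (f m) end.
Fixpoint nmax (n : nat) (f : nat -> nat) : nat :=
  match n with O => O | S m => Nat.max (nmax m f) (f m) end.
Fixpoint ncount (n : nat) (P : nat -> Prop) : nat :=
  match n with
  | O => O
  | S m => ncount m P + (if excluded_middle_informative (P m) then 1 else 0)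
  end%nat.

(** Sequences in A^{Z+}, A = {0,...,b-1}, are s : nat -> nat, 0-based:
    s 0 = i_1, s 1 = i_2, ... *)
Definition isseq (b : nat) (s : nat -> nat) : Prop := forall n, (s n < b)%nat.

(** Words u = (u_1,...,u_q) in A^q are encoded by the integer
    u_1 + u_2 b + ... + u_q b^(q-1) in {0,...,b^q - 1}. *)
Definition isword (b q k : nat) : Prop := (k < Nat.pow b q)%nat.
(** digit j (0-based) of the word k, i.e. u_(j+1) *)
Definition digit (b k j : nat) : nat := Nat.modulo (Nat.div k (Nat.pow b j)) b.
Definition xw (b q : nat) (x : R) (u : nat) : R := (x + INR u) / INR (Nat.pow b q).
Definition concat (b q k : nat) (u : nat -> nat) : nat -> nat :=
  fun j => if Nat.ltb j q then digit b k j else u (j - q)%nat.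

(** i_1 + i_2 b + ... + i_n b^(n-1), with n = m+1 *)
Definition pref (b : nat) (s : nat -> nat) (m : nat) : R :=
  sum_f_R0 (fun j => INR (s j) * INR b ^ j) m.

Definition S (b : nat) (gamma x : R) (s : nat -> nat) : R :=
  lim (fun N => sum_f_R0
         (fun m => gamma ^ m * psi ((x + pref b s m) / INR b ^ (S m))) N).

Definition Sd (b : nat) (gamma x0 : R) (s : nat -> nat) : R :=
  epsilon (inhabits 0)
    (fun l => derivable_pt_lim (fun x => S b gamma x s) x0 l).

Definition tangent (b : nat) (gamma x0 eps del : R) (s t : nat -> nat) : Prop :=
  Rabs (S b gamma x0 s - S b gamma x0 t) <= eps /\
  Rabs (Sd b gamma x0 s - Sd b gamma x0 t) <= del.

Definition inE (b : nat) (gamma : R) (q : nat) (x0 eps del : R) (k l : nat) : Prop :=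
  isword b q k /\ isword b q l /\
  exists u v, isseq b u /\ isseq b v /\
    tangent b gamma x0 eps del (concat b q k u) (concat b q l v).

Definition inEJ (b : nat) (gamma : R) (q : nat) (J : R -> Prop) (k l : nat) : Prop :=
  isword b q k /\ isword b q l /\
  forall eps del, 0 < eps -> 0 < del ->
    exists x, J x /\ inE b gamma q x eps del k l.

Definition eJ (b : nat) (gamma : R) (q : nat) (J : R -> Prop) : nat :=
  nmax (Nat.pow b q) (fun k => ncount (Nat.pow b q) (fun l => inEJ b gamma q J k l)).

Definition e (b : nat) (gamma : R) (q : nat) : R :=
  lim (fun p => INR (nmax (Nat.pow b p) (fun k =>
         eJ b gamma q (fun x => INR k / INR b ^ p <= x <= (INR k + 1) / INR b ^ p)))).

Inductive borel : (R -> Prop) -> Prop :=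
  | borel_int : forall a c, borel (fun x => a < x < c)
  | borel_compl : forall A, borel A -> borel (fun x => ~ A x)
  | borel_union : forall A : nat -> R -> Prop,
      (forall n, borel (A n)) -> borel (fun x => exists n, A n x)
  | borel_ext : forall A B, borel A -> (forall x, A x <-> B x) -> borel B.

Definition null (A : R -> Prop) : Prop :=
  forall eps, 0 < eps ->
    exists a c : nat -> R,
      (forall n, a n <= c n) /\
      (forall x, A x -> exists n, a n < x < c n) /\
      (forall N, sum_f_R0 (fun n => c n - a n) N <= eps).

Definition leb_meas (A : R -> Prop) : Prop :=
  exists B, borel B /\ null (fun x => ~ (A x <-> B x)).

Definition meas01 (f : R -> R) : Prop :=
  forall B, borel B -> leb_meas (fun x => 0 <= x < 1 /\ B (f x)).

Definition weight (w : R -> R) : Prop :=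
  meas01 w /\
  (forall x, 0 <= x < 1 -> 0 < w x) /\
  (exists M, forall x, 0 <= x < 1 -> w x <= M) /\
  (exists M, forall x, 0 <= x < 1 -> / w x <= M).

Definition admissible (b : nat) (gamma : R) (q : nat) (V : R -> nat -> nat -> R) : Prop :=
  (forall u v, isword b q u -> isword b q v -> meas01 (fun x => V x u v)) /\
  (forall x u v, 0 <= x < 1 -> isword b q u -> isword b q v -> 0 <= V x u v) /\
  exists eps del, 0 < eps /\ 0 < del /\
    forall x u v, 0 <= x < 1 -> inE b gamma q x eps del u v ->
      V x u v * V x v u >= 1.

Definition Sig (b q : nat) (V : R -> nat -> nat -> R) (w : R -> R) (x : R) : R :=
  rmax (Nat.pow b q) (fun u =>
    w x / w (xw b q x u) * rsum (Nat.pow b q) (fun v => V x u v)).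

Definition ess_le (f : R -> R) (M : R) : Prop :=
  null (fun x => 0 <= x < 1 /\ M < f x).

(** sigma(q) <= c   (sigma(q) = inf over (omega,V) of ||Sigma||_oo, in [0,+oo]) *)
Definition sigma_le (b : nat) (gamma : R) (q : nat) (c : R) : Prop :=
  forall eps, 0 < eps ->
    exists w V, weight w /\ admissible b gamma q V /\ ess_le (Sig b q V w) (c + eps).

Definition sigma_lt (b : nat) (gamma : R) (q : nat) (c : R) : Prop :=
  exists c', c' < c /\
    exists w V, weight w /\ admissible b gamma q V /\ ess_le (Sig b q V w) c'.

(* Main.v *)
From Coquelicot Require Import Coquelicot.
Require Import Defs.
From Stdlib Require Import Reals Ranalysis5 PSeries_reg Lra Lia Arith Classical ClassicalEpsilon.
Open Scope R_scope.

(** Tangency of two branches forces their first terms to agree up to the tails of the series.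
    For the cosine (derivative) condition this means that the points [2 pi (x + k) / b] and
    [2 pi (x + l) / b] have cosines at distance at most [2 gamma / (b - gamma)]; since cosine is
    monotone on each half of the circle, a window of this width contains few of the [b] equally
    spaced points, and [e(1) >= gamma b] leaves only [e(1) <= 2] when [b >= 4].
    Both conditions together bound the chord, [sin (pi |k - l| / b) <= gamma / (1 - gamma)],
    which excludes tangent pairs when [gamma b <= 2] and [b >= 6]. For [b = 6] and [gamma = 1/3]
    the two sides coincide; strictness holds because the sine cannot have absolute value 1 at both
    [y] and [6 y].
    For [b = 3] the tangency graph on the three branches is contained in a star at every [x],
    so [sigma(1) <= 1 + sqrt 2], while [e(1) = 3] forces [3 gamma > 1 + sqrt 2]. *)

(** * Counting, and the stabilization of [e] *)

Lemma ncount_le (n : nat) (P Q : nat -> Prop) :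
  (forall l, (l < n)%nat -> P l -> Q l) -> (ncount n P <= ncount n Q)%nat.
Proof.
  induction n as [|n IH]; intros H; simpl; [lia|].
  assert (ncount n P <= ncount n Q)%nat by (apply IH; intros; apply H; auto; lia).
  destruct (excluded_middle_informative (P n)) as [p|p];
    destruct (excluded_middle_informative (Q n)) as [q|q]; try lia.
  exfalso; apply q, H; auto; lia.
Qed.

Lemma ncount_split (n : nat) (P Q : nat -> Prop) :
  ncount n P = (ncount n (fun l => P l /\ Q l) + ncount n (fun l => P l /\ ~ Q l))%nat.
Proof.
  induction n as [|n IH]; simpl; [reflexivity|]. rewrite IH.
  destruct (excluded_middle_informative (P n)), (excluded_middle_informative (P n /\ Q n)),
    (excluded_middle_informative (P n /\ ~ Q n)); try lia; exfalso; tauto.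
Qed.

Lemma ncount_ge_bound (n a : nat) (P : nat -> Prop) :
  (forall l, (l < n)%nat -> P l -> (a <= l)%nat) -> (ncount n P <= n - a)%nat.
Proof.
  induction n as [|n IH]; intros H; cbn [ncount]; [lia|].
  assert (ncount n P <= n - a)%nat by (apply IH; intros; apply H; auto).
  destruct (excluded_middle_informative (P n)) as [p|p]; [|lia].
  assert (a <= n)%nat by (apply H; auto). lia.
Qed.

(** Pigeonhole: for [D >= 1], if no two elements of [P] were [D] or more apart, all of them would
    fit into [D] consecutive integers. *)
Lemma ncount_spread (n D : nat) (P : nat -> Prop) :
  (D < ncount n P)%nat ->
  exists l l', (l' < n)%nat /\ P l /\ P l' /\ (l + D <= l')%nat.
Proof.
  intros H. apply NNPP; intros N.
  assert (forall k, (k <= n)%nat -> (ncount k P <= D)%nat); [|specialize (H0 n (le_n n)); lia].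
  induction k as [|k IH]; intros Hk; cbn [ncount]; [lia|].
  destruct (excluded_middle_informative (P k)) as [p|p]; [|specialize (IH ltac:(lia)); lia].
  assert (ncount k P <= k - (k + 1 - D))%nat.
  { apply ncount_ge_bound. intros l Hl Pl.
    destruct (le_lt_dec (k + 1 - D) l); auto. exfalso; apply N.
    exists l, k. repeat split; auto; lia. }
  (* For [D = 0] the required pair is [k] with itself. *)
  destruct (le_lt_dec D 0) as [h|h]; [|lia].
  exfalso; apply N; exists k, k; repeat split; auto; lia.
Qed.

Lemma nmax_ge (n : nat) (f : nat -> nat) (k : nat) : (k < n)%nat -> (f k <= nmax n f)%nat.
Proof.
  induction n as [|n IH]; intros H; simpl; [lia|].
  destruct (Nat.eq_dec k n) as [->|]; [lia|]. specialize (IH ltac:(lia)); lia.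
Qed.

Lemma nmax_le (n : nat) (f : nat -> nat) (M : nat) :
  (forall k, (k < n)%nat -> (f k <= M)%nat) -> (nmax n f <= M)%nat.
Proof.
  induction n as [|n IH]; intros H; simpl; [lia|].
  apply Nat.max_lub; [apply IH; intros; apply H; lia | apply H; lia].
Qed.

Lemma nmax_attained (n : nat) (f : nat -> nat) :
  (0 < nmax n f)%nat -> exists k, (k < n)%nat /\ f k = nmax n f.
Proof.
  induction n as [|n IH]; simpl; intros H; [lia|].
  destruct (le_lt_dec (nmax n f) (f n)).
  - exists n; split; lia.
  - destruct IH as [k [Hk E]]; [lia|]. exists k; split; lia.
Qed.

Lemma rmax_le (n : nat) (f : nat -> R) (M : R) :
  (0 < n)%nat -> (forall k, (k < n)%nat -> f k <= M) -> rmax n f <= M.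
Proof.
  induction n as [|n IH]; intros Hn H; [lia|].
  destruct n as [|n]; [apply H; lia|].
  change (Rmax (rmax (Datatypes.S n) f) (f (Datatypes.S n)) <= M).
  apply Rmax_lub; [apply IH; [lia | intros; apply H; lia] | apply H; lia].
Qed.

Lemma rsum_indicator (n : nat) (P : nat -> Prop) :
  rsum n (fun v => if excluded_middle_informative (P v) then 1 else 0) = INR (ncount n P).
Proof.
  induction n as [|n IH]; simpl; [reflexivity|]. rewrite IH, plus_INR.
  destruct (excluded_middle_informative (P n)); simpl; ring.
Qed.

(** Induction on an upper bound [v] of some value [u p]: either a later value drops to a smaller
    bound, or the sequence stays at [v] from [p] on. *)
Lemma antitone_nat_eventually_constant (u : nat -> nat) :
  (forall p, (u (Datatypes.S p) <= u p)%nat) ->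
  exists m N, forall p, (N <= p)%nat -> u p = m.
Proof.
  intros H.
  assert (mono : forall p q, (p <= q)%nat -> (u q <= u p)%nat).
  { intros p q Hpq; induction Hpq as [|q Hpq IH]; [lia|]. specialize (H q); lia. }
  assert (forall v p, (u p <= v)%nat -> exists m N, forall p, (N <= p)%nat -> u p = m) as K.
  { induction v as [|v IH]; intros p Hp.
    - exists 0%nat, p. intros q Hq. specialize (mono p q Hq); lia.
    - destruct (classic (exists q, (p <= q)%nat /\ (u q <= v)%nat)) as [[q [_ Hq]]|N].
      + exact (IH q Hq).
      + exists (Datatypes.S v), p. intros q Hq.
        destruct (le_lt_dec (u q) v) as [h|h]; [exfalso; apply N; exists q; auto|].
        specialize (mono p q Hq); lia. }
  exact (K (u 0%nat) 0%nat (le_n _)).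
Qed.

Definition cell (b p k : nat) (x : R) : Prop :=
  INR k / INR b ^ p <= x <= (INR k + 1) / INR b ^ p.

Lemma inEJ_mono (b : nat) (gamma : R) (q : nat) (J J' : R -> Prop) (k l : nat) :
  (forall x, J x -> J' x) -> inEJ b gamma q J k l -> inEJ b gamma q J' k l.
Proof.
  intros H [Hk [Hl HE]]. split; [|split]; auto. intros eps del He Hd.
  destruct (HE eps del He Hd) as [x [Jx Ex]]. exists x; auto.
Qed.

Lemma eJ_mono (b : nat) (gamma : R) (q : nat) (J J' : R -> Prop) :
  (forall x, J x -> J' x) -> (eJ b gamma q J <= eJ b gamma q J')%nat.
Proof.
  intros H. apply nmax_le. intros k Hk.
  etransitivity; [|apply (nmax_ge _ (fun k => ncount _ (fun l => inEJ b gamma q J' k l)) k Hk)].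
  apply ncount_le. intros l _. apply inEJ_mono, H.
Qed.

(** The intervals of level [p + 1] refine those of level [p], which makes the maxima in the
    definition of [e] antitone in [p]. *)
Lemma cell_parent (b p k : nat) (x : R) :
  (2 <= b)%nat -> cell b (Datatypes.S p) k x -> cell b p (k / b) x.
Proof.
  intros hb [H1 H2].
  assert (B : 2 <= INR b) by (apply (le_INR 2); auto).
  assert (P : 0 < INR b ^ p) by (apply pow_lt; lra).
  simpl in H1, H2.
  assert (E1 : INR b * INR (k / b) <= INR k).
  { rewrite <- mult_INR. apply le_INR, Nat.Div0.mul_div_le. }
  assert (E2 : INR k + 1 <= INR b * (INR (k / b) + 1)).
  { rewrite <- !S_INR, <- mult_INR. apply le_INR.
    assert (k < b * Datatypes.S (k / b))%nat by (apply Nat.mul_succ_div_gt; lia). lia. }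
  assert (X1 : INR k <= x * (INR b * INR b ^ p)).
  { apply Rmult_le_reg_r with (/ (INR b * INR b ^ p)); [apply Rinv_0_lt_compat; nra|].
    rewrite Rmult_assoc, Rinv_r by nra. unfold Rdiv in H1; lra. }
  assert (X2 : x * (INR b * INR b ^ p) <= INR k + 1).
  { apply Rmult_le_reg_r with (/ (INR b * INR b ^ p)); [apply Rinv_0_lt_compat; nra|].
    rewrite Rmult_assoc, Rinv_r by nra. unfold Rdiv in H2; lra. }
  assert (Y1 : INR (k / b) <= x * INR b ^ p) by nra.
  assert (Y2 : x * INR b ^ p <= INR (k / b) + 1) by nra.
  split; apply Rmult_le_reg_r with (INR b ^ p); auto; unfold Rdiv;
    rewrite Rmult_assoc, Rinv_l; lra.
Qed.

(** The maxima are natural numbers and do not increase under refinement, so they stabilize. Hence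
    [e] is a natural number, attained at every sufficiently fine level. *)
Lemma e_eventually (b : nat) (gamma : R) (q : nat) : (2 <= b)%nat ->
  exists m N, e b gamma q = INR m /\
    forall p, (N <= p)%nat -> nmax (Nat.pow b p) (fun k => eJ b gamma q (cell b p k)) = m.
Proof.
  intros hb.
  destruct (antitone_nat_eventually_constant
    (fun p => nmax (Nat.pow b p) (fun k => eJ b gamma q (cell b p k)))) as [m [N H]].
  { intros p. apply nmax_le. intros k Hk.
    assert (k / b < Nat.pow b p)%nat by (apply Nat.Div0.div_lt_upper_bound; simpl in Hk; lia).
    etransitivity; [|apply (nmax_ge _ (fun k => eJ b gamma q (cell b p k)) (k / b)); auto].
    apply eJ_mono. intros x. apply cell_parent; auto. }
  exists m, N. split; auto.
  unfold e, lim.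
  (* [epsilon] returns some limit as soon as one exists; uniqueness of limits identifies it. *)
  match goal with |- epsilon ?i ?P = _ => set (Q := P); assert (HQ : Q (INR m)) end.
  { intros eps He. exists N. intros n Hn. rewrite <- (H n Hn). unfold cell.
    rewrite R_dist_eq. auto. }
  assert (HE := epsilon_spec (inhabits 0) Q (ex_intro _ _ HQ)).
  exact (UL_sequence _ _ _ HE HQ).
Qed.

(** * Measurability and [sigma(q) <= e(q)] *)

Lemma borel_true : borel (fun _ => True).
Proof.
  apply (borel_ext (fun x => exists n : nat, - INR n < x < INR n)).
  - apply borel_union. intros n. apply borel_int.
  - intros x; split; auto. intros _.
    destruct (INR_unbounded (Rabs x)) as [n Hn]. exists n.
    apply Rabs_def2 in Hn. lra.
Qed.

Lemma borel_const (P : Prop) : borel (fun _ => P).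
Proof.
  destruct (classic P) as [p|p].
  - apply (borel_ext (fun _ => True)); [apply borel_true | tauto].
  - apply (borel_ext (fun _ => ~ True)); [apply (borel_compl _ borel_true) | tauto].
Qed.

Lemma borel_or (A B : R -> Prop) : borel A -> borel B -> borel (fun x => A x \/ B x).
Proof.
  intros HA HB.
  apply (borel_ext (fun x => exists n : nat, (match n with O => A | _ => B end) x)).
  - apply borel_union. intros [|n]; auto.
  - intros x; split.
    + intros [[|n] H]; auto.
    + intros [H|H]; [exists 0%nat | exists 1%nat]; auto.
Qed.

Lemma borel_and (A B : R -> Prop) : borel A -> borel B -> borel (fun x => A x /\ B x).
Proof.
  intros HA HB.
  apply (borel_ext (fun x => ~ (~ A x \/ ~ B x))).
  - apply (borel_compl (fun x => ~ A x \/ ~ B x)), borel_or; apply borel_compl; auto.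
  - intros x; tauto.
Qed.

Lemma borel_lt (c : R) : borel (fun x => x < c).
Proof.
  apply (borel_ext (fun x => exists n : nat, - INR n < x < c)).
  - apply borel_union. intros n. apply borel_int.
  - intros x; split; [intros [n H]; lra|]. intros H.
    destruct (INR_unbounded (Rabs x)) as [n Hn]. exists n.
    apply Rabs_def2 in Hn. lra.
Qed.

Lemma borel_ge (c : R) : borel (fun x => c <= x).
Proof.
  apply (borel_ext (fun x => ~ x < c)); [apply (borel_compl _ (borel_lt c))|].
  intros x; split; lra.
Qed.

Lemma null_empty (A : R -> Prop) : (forall x, ~ A x) -> null A.
Proof.
  intros H eps He. exists (fun _ => 0), (fun _ => 0). split; [|split].
  - intros; lra.
  - intros x Ax. destruct (H x Ax).
  - intros N. rewrite (sum_eq _ (fun _ => 0) N) by (intros; ring). rewrite sum_cte; lra.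
Qed.

Lemma meas01_two_valued (A : R -> Prop) (c1 c2 : R) :
  borel A -> meas01 (fun x => if excluded_middle_informative (A x) then c1 else c2).
Proof.
  intros HA B HB.
  exists (fun x => (0 <= x /\ x < 1) /\ ((A x /\ B c1) \/ (~ A x /\ B c2))). split.
  - apply borel_and; [apply borel_and; [apply borel_ge | apply borel_lt]|].
    apply borel_or; apply borel_and; auto using borel_const.
    apply (borel_compl _ HA).
  - apply null_empty. intros x H; apply H.
    destruct (excluded_middle_informative (A x)); tauto.
Qed.

Lemma weight_one : weight (fun _ => 1).
Proof.
  split; [|split; [|split]].
  - intros B HB. exists (fun x => (0 <= x /\ x < 1) /\ B 1). split.
    + apply borel_and; [apply borel_and; [apply borel_ge | apply borel_lt]|].
      apply borel_const.
    + apply null_empty. intros x H; apply H; tauto.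
  - intros; lra.
  - exists 1; intros; lra.
  - exists 1; intros; lra.
Qed.

Lemma ess_le_of_le (f : R -> R) (M : R) :
  (forall x, 0 <= x < 1 -> f x <= M) -> ess_le f M.
Proof.
  intros H. apply null_empty. intros x [Hx Hf]. specialize (H x Hx); lra.
Qed.

Lemma Sig_one_le (b q : nat) (V : R -> nat -> nat -> R) (x M : R) : (0 < b)%nat ->
  (forall u, (u < Nat.pow b q)%nat -> rsum (Nat.pow b q) (V x u) <= M) ->
  Sig b q V (fun _ => 1) x <= M.
Proof.
  intros hb H. unfold Sig. apply rmax_le.
  - assert (Nat.pow b q <> 0)%nat by (apply Nat.pow_nonzero; lia). lia.
  - intros u Hu. replace (1 / 1) with 1 by field. rewrite Rmult_1_l. apply H; auto.
Qed.

Lemma inE_sym (b : nat) (gamma : R) (q : nat) (x eps del : R) (k l : nat) :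
  inE b gamma q x eps del k l -> inE b gamma q x eps del l k.
Proof.
  intros [Hk [Hl [u [v [Hu [Hv [T1 T2]]]]]]]. split; [|split]; auto.
  exists v, u. split; [|split]; auto. split; rewrite Rabs_minus_sym; auto.
Qed.

Lemma inE_weaken (b : nat) (gamma : R) (q : nat) (x eps del eps' del' : R) (k l : nat) :
  eps <= eps' -> del <= del' ->
  inE b gamma q x eps del k l -> inE b gamma q x eps' del' k l.
Proof.
  intros H1 H2 [Hk [Hl [u [v [Hu [Hv [T1 T2]]]]]]]. split; [|split]; auto.
  exists u, v. split; [|split]; auto. split; eapply Rle_trans; eauto.
Qed.

Lemma common_eps (n : nat) (P : nat -> R -> Prop) :
  (forall i e1 e2, e1 <= e2 -> P i e2 -> P i e1) ->
  (forall i, (i < n)%nat -> exists e0, 0 < e0 /\ P i e0) ->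
  exists e0, 0 < e0 /\ forall i, (i < n)%nat -> P i e0.
Proof.
  intros mono; induction n as [|n IH]; intros H.
  - exists 1; split; [lra | intros; lia].
  - destruct IH as [e1 [He1 K1]]; [intros; apply H; lia|].
    destruct (H n ltac:(lia)) as [e2 [He2 K2]].
    exists (Rmin e1 e2). split; [apply Rmin_glb_lt; auto|].
    intros i Hi. destruct (Nat.eq_dec i n) as [->|].
    + eapply mono; [apply Rmin_r | auto].
    + eapply mono; [apply Rmin_l | apply K1; lia].
Qed.

Lemma exists_cell (b p : nat) (x : R) : (2 <= b)%nat -> 0 <= x < 1 ->
  exists k, (k < Nat.pow b p)%nat /\ INR k / INR b ^ p <= x < (INR k + 1) / INR b ^ p.
Proof.
  intros hb Hx.
  assert (B : 2 <= INR b) by (apply (le_INR 2); auto).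
  assert (P : 0 < INR b ^ p) by (apply pow_lt; lra).
  assert (K : forall n, x * INR b ^ p < INR n ->
    exists k, (k < n)%nat /\ INR k <= x * INR b ^ p < INR k + 1).
  { induction n as [|n IH]; intros Hn; [simpl in Hn; nra|].
    rewrite S_INR in Hn. destruct (Rlt_le_dec (x * INR b ^ p) (INR n)) as [h|h].
    - destruct (IH h) as [k [Hk Ek]]; exists k; split; auto.
    - exists n; split; auto. }
  destruct (K (Nat.pow b p)) as [k [Hk [E1 E2]]]; [rewrite pow_INR; nra|].
  exists k. split; auto. split.
  - apply Rmult_le_reg_r with (INR b ^ p); auto.
    unfold Rdiv. rewrite Rmult_assoc, Rinv_l; lra.
  - apply Rmult_lt_reg_r with (INR b ^ p); auto.
    unfold Rdiv. rewrite Rmult_assoc, Rinv_l; lra.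
Qed.

Lemma cell_unique (M x : R) (k l : nat) : 0 < M ->
  INR k / M <= x < (INR k + 1) / M -> INR l / M <= x < (INR l + 1) / M -> k = l.
Proof.
  intros HM H1 H2.
  assert (C : forall i, INR i / M <= x < (INR i + 1) / M -> INR i <= x * M < INR i + 1).
  { intros i [A B]. split.
    - apply Rmult_le_reg_r with (/ M); [apply Rinv_0_lt_compat; auto|].
      rewrite Rmult_assoc, Rinv_r; unfold Rdiv in A; lra.
    - apply Rmult_lt_reg_r with (/ M); [apply Rinv_0_lt_compat; auto|].
      rewrite Rmult_assoc, Rinv_r; unfold Rdiv in B; lra. }
  apply C in H1; apply C in H2.
  assert (k < Datatypes.S l)%nat by (apply INR_lt; rewrite S_INR; lra).
  assert (l < Datatypes.S k)%nat by (apply INR_lt; rewrite S_INR; lra). lia.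
Qed.

(* The testing function is the indicator of [E(q, I)], where [I] is the [b]-adic interval
   of a fixed fine level containing [x]. *)
Lemma sigma_le_e (b : nat) (gamma : R) (q : nat) :
  (2 <= b)%nat -> sigma_le b gamma q (e b gamma q).
Proof.
  intros hb eps Heps.
  destruct (e_eventually b gamma q hb) as [m [p [Em Hp]]].
  specialize (Hp p (le_n p)).
  assert (B : 2 <= INR b) by (apply (le_INR 2); auto).
  assert (P : 0 < INR b ^ p) by (apply pow_lt; lra).
  (* Half-open intervals are used here, so that each [x] selects exactly one [k] and a row sum of
     the indicator is a single row count of E(q, I). *)
  set (A := fun u v x => exists k, ((k < Nat.pow b p)%nat /\ inEJ b gamma q (cell b p k) u v)
    /\ (INR k / INR b ^ p <= x /\ x < (INR k + 1) / INR b ^ p)).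
  exists (fun _ => 1),
    (fun x u v => if excluded_middle_informative (A u v x) then 1 else 0).
  split; [apply weight_one|]. split.
  - split; [|split].
    + intros u v _ _. apply meas01_two_valued.
      apply borel_union. intros k. apply borel_and; [apply borel_const|].
      apply borel_and; [apply borel_ge | apply borel_lt].
    + intros x u v _ _ _. destruct (excluded_middle_informative (A u v x)); lra.
    (* For each triple [k u v], either the pair belongs to E(q, I) or some threshold excludes it on
       the whole interval. There are finitely many triples, so one threshold [d] serves them all. *)
    + set (Q := fun k u v d => inEJ b gamma q (cell b p k) u v \/
        forall x, cell b p k x -> ~ inE b gamma q x d d u v).
      assert (mono : forall k u v e1 e2, e1 <= e2 -> Q k u v e2 -> Q k u v e1).
      { intros k u v e1 e2 He [H|H]; [left; auto|right].
        intros x Hx Hin. apply (H x Hx). revert Hin; apply inE_weaken; auto. }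
      destruct (common_eps (Nat.pow b p) (fun k d => forall u, (u < Nat.pow b q)%nat ->
        forall v, (v < Nat.pow b q)%nat -> Q k u v d)) as [d [Hd HQ]].
      { intros k e1 e2 He H u Hu v Hv. apply (mono k u v e1 e2 He), H; auto. }
      { intros k Hk. apply (common_eps _ (fun u d => forall v, (v < Nat.pow b q)%nat -> Q k u v d)).
        { intros u e1 e2 He H v Hv. apply (mono k u v e1 e2 He), H; auto. }
        intros u Hu. apply (common_eps _ (fun v d => Q k u v d)).
        { intros v e1 e2 He H. apply (mono k u v e1 e2 He), H; auto. }
        intros v Hv.
        destruct (classic (inEJ b gamma q (cell b p k) u v)) as [h|h].
        { exists 1; split; [lra | left; auto]. }
        apply NNPP; intros N. apply h. split; [|split]; auto.
        intros e1 e2 He1 He2. apply NNPP; intros N'. apply N.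
        exists (Rmin e1 e2). split; [apply Rmin_glb_lt; auto|]. right.
        intros x Hx Hin. apply N'. exists x; split; auto.
        revert Hin; apply inE_weaken; [apply Rmin_l | apply Rmin_r]. }
      exists d, d. split; [|split]; auto.
      assert (HA : forall x u v, 0 <= x < 1 -> inE b gamma q x d d u v -> A u v x).
      { intros x u v Hx Hin. destruct (exists_cell b p x hb Hx) as [k [Hk Ck]].
        exists k. split; [split|]; auto.
        assert (Hin' := Hin). destruct Hin' as [Hu [Hv _]].
        destruct (HQ k Hk u Hu v Hv) as [h|h]; auto.
        destruct (h x); auto. split; lra. }
      intros x u v Hx Hin.
      destruct (excluded_middle_informative (A u v x)) as [h|h];
        [|destruct h; apply HA; auto].
      destruct (excluded_middle_informative (A v u x)) as [h'|h'];
        [lra | destruct h'; apply HA; auto using inE_sym].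
  - apply ess_le_of_le. intros x Hx. apply Sig_one_le; [lia|]. intros u Hu.
    rewrite (rsum_indicator _ (fun v => A u v x)).
    apply Rle_trans with (INR m); [|lra]. apply le_INR. rewrite <- Hp.
    destruct (exists_cell b p x hb Hx) as [k [Hk Ck]].
    etransitivity; [|apply (nmax_ge _ (fun k => eJ b gamma q (cell b p k)) k Hk)].
    etransitivity;
      [|apply (nmax_ge _ (fun u => ncount _ (fun v => inEJ b gamma q (cell b p k) u v)) u Hu)].
    apply ncount_le. intros v _ [k' [[Hk' Ek'] Ck']].
    rewrite (cell_unique _ _ _ _ P Ck Ck'); auto.
Qed.

Lemma sigma_lt_of_le (b : nat) (gamma : R) (q : nat) (c d : R) :
  sigma_le b gamma q c -> c < d -> sigma_lt b gamma q d.
Proof.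
  intros H Hcd. exists (c + (d - c) / 2). split; [lra|]. apply H. lra.
Qed.

(** * Series for [S] and its derivative *)

Lemma geom_ex_series (a : nat -> R) (C r : R) : 0 <= r < 1 ->
  (forall m, Rabs (a m) <= C * r ^ m) -> ex_series a.
Proof.
  intros Hr H. apply (@ex_series_le R_AbsRing R_CompleteNormedModule a (fun m => C * r ^ m)).
  - exact H.
  - apply (@ex_series_scal_l R_AbsRing R_NormedModule C (fun m => r ^ m)), ex_series_geom.
    rewrite Rabs_pos_eq; lra.
Qed.

Lemma geom_Series_bound (a : nat -> R) (C r : R) : 0 <= r < 1 ->
  (forall m, Rabs (a m) <= C * r ^ m) -> Rabs (Series a) <= C / (1 - r).
Proof.
  intros Hr H.
  assert (Hg : ex_series (fun m => C * r ^ m)).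
  { apply (@ex_series_scal_l R_AbsRing R_NormedModule C (fun m => r ^ m)), ex_series_geom.
    rewrite Rabs_pos_eq; lra. }
  assert (Ha : ex_series (fun m => Rabs (a m))).
  { apply (@ex_series_le R_AbsRing R_CompleteNormedModule _ (fun m => C * r ^ m)); auto.
    intros m. change (Rabs (Rabs (a m)) <= C * r ^ m). rewrite Rabs_Rabsolu; auto. }
  eapply Rle_trans; [apply Series_Rabs; auto|].
  eapply Rle_trans; [apply (Series_le _ (fun m => C * r ^ m)); auto|].
  - intros m; split; [apply Rabs_pos | auto].
  - rewrite Series_scal_l, Series_geom by (rewrite Rabs_pos_eq; lra). apply Rle_refl.
Qed.

Lemma geom_Series_tail (a : nat -> R) (C r : R) (n : nat) : 0 <= r < 1 ->
  (forall m, Rabs (a m) <= C * r ^ m) ->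
  Rabs (Series a - sum_f_R0 a n) <= C * r ^ Datatypes.S n / (1 - r).
Proof.
  intros Hr H.
  rewrite (Series_incr_n a (Datatypes.S n)); [|lia | apply (geom_ex_series a C r); auto].
  simpl pred. match goal with |- Rabs (?u + ?v - ?u) <= _ =>
    replace (u + v - u) with v by ring end.
  apply geom_Series_bound; auto. intros m. eapply Rle_trans; [apply H|].
  rewrite pow_add. right; ring.
Qed.

Lemma pow_tail_eventually_small (K r : R) : 0 <= r < 1 ->
  forall eps, 0 < eps -> exists N, forall n, (N <= n)%nat -> K * r ^ n < eps.
Proof.
  intros Hr eps He.
  assert (HK : 0 < Rabs K + 1) by (assert (h := Rabs_pos K); lra).
  destruct (pow_lt_1_zero r) with (y := eps / (Rabs K + 1)) as [N HN].
  - rewrite Rabs_pos_eq; lra.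
  - apply Rdiv_lt_0_compat; auto.
  - exists N. intros n Hn. specialize (HN n Hn).
    assert (Hp : 0 <= r ^ n) by (apply pow_le; lra).
    rewrite Rabs_pos_eq in HN by auto.
    apply Rle_lt_trans with ((Rabs K + 1) * r ^ n).
    + apply Rmult_le_compat_r; auto. assert (h := Rle_abs K); lra.
    + apply Rmult_lt_reg_r with (/ (Rabs K + 1)); [apply Rinv_0_lt_compat; auto|].
      replace ((Rabs K + 1) * r ^ n * / (Rabs K + 1)) with (r ^ n) by (field; lra).
      exact HN.
Qed.

(** Weierstrass test: the geometric majorant makes the partial sums of the derivatives converge
    uniformly near [x], which permits differentiation term by term. *)
Lemma derivable_pt_lim_Series (f f' : nat -> R -> R) (C r : R) : 0 <= r < 1 ->
  (forall m y, derivable_pt_lim (f m) y (f' m y)) ->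
  (forall m, continuity (f' m)) ->
  (forall m y, Rabs (f m y) <= C * r ^ m) ->
  (forall m y, Rabs (f' m y) <= C * r ^ m) ->
  forall x, derivable_pt_lim (fun y => Series (fun m => f m y)) x (Series (fun m => f' m x)).
Proof.
  intros Hr Hd Hc Hf Hf' x.
  assert (T : forall eps, 0 < eps -> exists N, forall n, (N <= n)%nat ->
    C * r ^ Datatypes.S n / (1 - r) < eps).
  { intros eps He.
    destruct (pow_tail_eventually_small (C * r / (1 - r)) r Hr eps He) as [N HN].
    exists N. intros n Hn. specialize (HN n Hn).
    replace (C * r ^ Datatypes.S n / (1 - r)) with (C * r / (1 - r) * r ^ n); auto.
    simpl; field; lra. }
  assert (U : CVU (fun n y => sum_f_R0 (fun m => f' m y) n) (fun y => Series (fun m => f' m y))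
     x (mkposreal 1 Rlt_0_1)).
  { intros eps He. destruct (T eps He) as [N HN]. exists N. intros n y Hn _.
    eapply Rle_lt_trans; [apply (geom_Series_tail (fun m => f' m y) C r); auto | auto]. }
  apply (derivable_pt_lim_CVU (fun n y => sum_f_R0 (fun m => f m y) n)
    (fun n y => sum_f_R0 (fun m => f' m y) n) _ (fun y => Series (fun m => f' m y)) x x
    (mkposreal 1 Rlt_0_1)); auto.
  - unfold Boule; simpl. rewrite Rminus_diag, Rabs_R0; lra.
  - intros y n _. induction n as [|n IH]; simpl; [apply Hd|].
    apply (derivable_pt_lim_plus _ _ _ _ _ IH (Hd _ _)).
  - intros y _ eps He. destruct (T eps He) as [N HN]. exists N. intros n Hn.
    unfold Rdist. rewrite Rabs_minus_sym.
    eapply Rle_lt_trans; [apply (geom_Series_tail (fun m => f m y) C r); auto | auto].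
  - intros y Hy. apply (CVU_continuity _ _ _ _ U); auto.
    intros n z _. induction n as [|n IH]; simpl; [apply Hc|].
    apply (continuity_pt_plus _ _ _ IH (Hc _ _)).
Qed.

Definition ang (b : nat) (x : R) (s : nat -> nat) (m : nat) : R :=
  2 * PI * ((x + pref b s m) / INR b ^ Datatypes.S m).

Lemma Rabs_scaled_le (K p s : R) : 0 <= p -> -1 <= s <= 1 -> Rabs (K * (p * s)) <= Rabs K * p.
Proof.
  intros Hp Hs. rewrite !Rabs_mult, (Rabs_pos_eq p) by auto.
  apply Rabs_le in Hs. assert (h := Rabs_pos K).
  apply Rmult_le_compat_l; auto. nra.
Qed.

Lemma S_eq_Series (b : nat) (gamma x : R) (s : nat -> nat) : 0 <= gamma < 1 ->
  S b gamma x s = - (2 * PI) * Series (fun m => gamma ^ m * sin (ang b x s m)).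
Proof.
  intros Hg. rewrite <- Series_scal_l. unfold S, lim.
  match goal with |- epsilon ?i ?P = ?l => set (Q := P); assert (HQ : Q l) end.
  { intros eps He.
    assert (B : forall m, Rabs (- (2 * PI) * (gamma ^ m * sin (ang b x s m)))
      <= (2 * PI) * gamma ^ m).
    { intros m. assert (h := PI_RGT_0).
      rewrite <- (Rabs_pos_eq (2 * PI)) at 2 by lra. rewrite <- (Rabs_Ropp (2 * PI)).
      apply Rabs_scaled_le; [apply pow_le; lra | apply SIN_bound]. }
    destruct (pow_tail_eventually_small (2 * PI * gamma / (1 - gamma)) gamma Hg eps He) as [N HN].
    exists N. intros n Hn. specialize (HN n Hn).
    unfold Rdist. rewrite Rabs_minus_sym.
    match goal with |- Rabs (?u - sum_f_R0 ?v n) < _ =>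
      rewrite (sum_eq v (fun m => - (2 * PI) * (gamma ^ m * sin (ang b x s m))) n) end.
    - eapply Rle_lt_trans; [apply (geom_Series_tail _ (2 * PI) gamma n Hg B)|].
      replace (2 * PI * gamma ^ Datatypes.S n / (1 - gamma))
        with (2 * PI * gamma / (1 - gamma) * gamma ^ n); auto. simpl; field; lra.
    - intros m _. unfold psi, ang. simpl. ring. }
  assert (HE := epsilon_spec (inhabits 0) Q (ex_intro _ _ HQ)).
  exact (UL_sequence _ _ _ HE HQ).
Qed.

(** Differentiation multiplies term [m] by 2 pi / b^(m+1), which turns the ratio [gamma] into
    [gamma / b]. *)
Lemma Sd_eq_Series (b : nat) (gamma x : R) (s : nat -> nat) : (2 <= b)%nat -> 0 <= gamma < 1 ->
  Sd b gamma x s =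
    - (2 * PI) * (2 * PI) / INR b * Series (fun m => (gamma / INR b) ^ m * cos (ang b x s m)).
Proof.
  intros hb Hg.
  assert (B : 2 <= INR b) by (apply (le_INR 2); auto).
  assert (HP := PI_RGT_0).
  rewrite <- Series_scal_l. unfold Sd.
  match goal with |- epsilon ?i ?P = ?l => set (Q := P); assert (HQ : Q l) end.
  { set (f := fun m y => - (2 * PI) * (gamma ^ m * sin (ang b y s m))).
    set (f' := fun m y => - (2 * PI) * (2 * PI) / INR b
       * ((gamma / INR b) ^ m * cos (ang b y s m))).
    (* The majorant (2 pi)^2 gamma^m covers both the terms and their derivatives. *)
    assert (D : derivable_pt_lim (fun y => Series (fun m => f m y)) x (Series (fun m => f' m x))).
    { apply (derivable_pt_lim_Series f f' (2 * PI * (2 * PI)) gamma Hg).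
      - intros m y. apply is_derive_Reals. unfold f, f', ang.
        assert (INR b ^ m <> 0) by (apply pow_nonzero; lra).
        auto_derive; auto. simpl. unfold Rdiv. rewrite Rpow_mult_distr, pow_inv. field. split; lra.
      - intros m y. apply derivable_continuous_pt. unfold f', ang. reg.
      - intros m y. unfold f. assert (h1 := pow_le gamma m (proj1 Hg)).
        eapply Rle_trans; [apply Rabs_scaled_le; [auto | apply SIN_bound]|].
        rewrite Rabs_Ropp, Rabs_pos_eq by lra. assert (h3 := PI2_1).
        apply Rmult_le_compat_r; [auto | nra].
      - intros m y. unfold f'.
        assert (h4 : 0 <= gamma / INR b <= gamma).
        { split; [apply Rdiv_le_0_compat; lra|]. apply Rle_div_l; [lra|]. nra. }
        assert (h5 := pow_incr _ _ m h4). assert (h6 := pow_le _ m (proj1 h4)).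
        eapply Rle_trans; [apply Rabs_scaled_le; [auto | apply COS_bound]|].
        assert (h7 : Rabs (- (2 * PI) * (2 * PI) / INR b) <= 2 * PI * (2 * PI)).
        { replace (- (2 * PI) * (2 * PI) / INR b) with (- (2 * PI * (2 * PI) / INR b))
            by (field; lra).
          rewrite Rabs_Ropp, Rabs_pos_eq by (apply Rdiv_le_0_compat; nra).
          apply Rle_div_l; [lra|]. nra. }
        apply Rmult_le_compat; auto using Rabs_pos; lra. }
    unfold Q. eapply derivable_pt_lim_ext; [|exact D].
    intros y. simpl. rewrite S_eq_Series by auto. unfold f. now rewrite Series_scal_l. }
  assert (HE := epsilon_spec (inhabits 0) Q (ex_intro _ _ HQ)).
  exact (uniqueness_limite _ _ _ _ HE HQ).
Qed.

(** * First-digit estimates for tangent pairs *)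

Lemma tangent_sin_series (b : nat) (gamma x eps del : R) (s t : nat -> nat) : 0 <= gamma < 1 ->
  tangent b gamma x eps del s t ->
  Rabs (Series (fun m => gamma ^ m * (sin (ang b x s m) - sin (ang b x t m)))) <= eps.
Proof.
  intros Hg [T _]. rewrite !S_eq_Series in T by auto.
  assert (HP := PI2_1).
  assert (E : forall s, ex_series (fun m => gamma ^ m * sin (ang b x s m))).
  { intros s'. apply (geom_ex_series _ 1 gamma Hg). intros m.
    rewrite <- Rabs_R1, <- (Rmult_1_l (gamma ^ m * sin _)).
    apply Rabs_scaled_le; [apply pow_le; lra | apply SIN_bound]. }
  rewrite (Series_ext _ (fun m => gamma ^ m * sin (ang b x s m) - gamma ^ m * sin (ang b x t m)))
    by (intros; ring).
  rewrite Series_minus by auto.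
  match goal with |- Rabs (?u - ?v) <= _ => set (U := u) in *; set (W := v) in * end.
  replace (- (2 * PI) * U - - (2 * PI) * W) with (- (2 * PI * (U - W))) in T by ring.
  rewrite Rabs_Ropp, Rabs_mult, (Rabs_pos_eq (2 * PI)) in T by lra.
  assert (h := Rabs_pos (U - W)). nra.
Qed.

(** The prefactor (2 pi)^2 / b of the derivative is at least 1 / b; removing it costs the factor
    [INR b] on the right. *)
Lemma tangent_cos_series (b : nat) (gamma x eps del : R) (s t : nat -> nat) :
  (2 <= b)%nat -> 0 <= gamma < 1 -> tangent b gamma x eps del s t ->
  Rabs (Series (fun m => (gamma / INR b) ^ m * (cos (ang b x s m) - cos (ang b x t m))))
    <= del * INR b.
Proof.
  intros hb Hg [_ T]. rewrite !Sd_eq_Series in T by auto.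
  assert (B : 2 <= INR b) by (apply (le_INR 2); auto).
  assert (HP := PI2_1).
  assert (Hr : 0 <= gamma / INR b < 1).
  { split; [apply Rdiv_le_0_compat; lra|]. apply Rlt_div_l; lra. }
  assert (E : forall s, ex_series (fun m => (gamma / INR b) ^ m * cos (ang b x s m))).
  { intros s'. apply (geom_ex_series _ 1 (gamma / INR b) Hr). intros m.
    rewrite <- Rabs_R1, <- (Rmult_1_l (_ ^ m * cos _)).
    apply Rabs_scaled_le; [apply pow_le; lra | apply COS_bound]. }
  rewrite (Series_ext _ (fun m => (gamma / INR b) ^ m * cos (ang b x s m)
    - (gamma / INR b) ^ m * cos (ang b x t m))) by (intros; ring).
  rewrite Series_minus by auto.
  match goal with |- Rabs (?u - ?v) <= _ => set (U := u) in *; set (W := v) in * end.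
  replace (- (2 * PI) * (2 * PI) / INR b * U - - (2 * PI) * (2 * PI) / INR b * W)
    with (- (2 * PI * (2 * PI) / INR b * (U - W))) in T by (field; lra).
  rewrite Rabs_Ropp, Rabs_mult, (Rabs_pos_eq (_ / _)) in T
    by (apply Rdiv_le_0_compat; nra).
  assert (h := Rabs_pos (U - W)).
  assert (T' : 2 * PI * (2 * PI) * Rabs (U - W) <= del * INR b).
  { apply Rmult_le_compat_r with (r := INR b) in T; [|lra].
    replace (2 * PI * (2 * PI) * Rabs (U - W))
      with (2 * PI * (2 * PI) / INR b * Rabs (U - W) * INR b) by (field; lra). exact T. }
  assert (1 <= 2 * PI * (2 * PI)) by nra. nra.
Qed.

(** Each cosine difference is at most 2, and the terms from [m = 1] on have ratio [gamma / b], so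
    they contribute at most 2 gamma / (b - gamma). *)
Lemma tangent_cos_first (b : nat) (gamma x eps del : R) (s t : nat -> nat) :
  (2 <= b)%nat -> 0 <= gamma < 1 -> tangent b gamma x eps del s t ->
  Rabs (cos (ang b x s 0) - cos (ang b x t 0)) <= 2 * (gamma / (INR b - gamma)) + del * INR b.
Proof.
  intros hb Hg T.
  assert (B : 2 <= INR b) by (apply (le_INR 2); auto).
  assert (Hr : 0 <= gamma / INR b < 1).
  { split; [apply Rdiv_le_0_compat; lra|]. apply Rlt_div_l; lra. }
  apply tangent_cos_series in T; auto.
  set (a := fun m => (gamma / INR b) ^ m * (cos (ang b x s m) - cos (ang b x t m))) in T.
  assert (H := geom_Series_tail a 2 (gamma / INR b) 0 Hr).
  assert (Ha : forall m, Rabs (a m) <= 2 * (gamma / INR b) ^ m).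
  { intros m. unfold a. assert (h := pow_le _ m (proj1 Hr)).
    rewrite Rabs_mult, Rabs_pos_eq by auto.
    assert (Rabs (cos (ang b x s m) - cos (ang b x t m)) <= 2); [|nra].
    apply Rabs_le. destruct (COS_bound (ang b x s m)), (COS_bound (ang b x t m)). lra. }
  specialize (H Ha). simpl sum_f_R0 in H.
  replace (2 * (gamma / INR b) ^ 1 / (1 - gamma / INR b))
    with (2 * (gamma / (INR b - gamma))) in H by (field; lra).
  replace (cos (ang b x s 0) - cos (ang b x t 0)) with (Series a - (Series a - a 0%nat)).
  - assert (h := Rabs_triang (Series a) (- (Series a - a 0%nat))).
    rewrite Rabs_Ropp in h. unfold Rminus at 1. lra.
  - unfold a; simpl; ring.
Qed.

(** Component along (al, be) of the vector (sin, cos / b^m). The factor 1 / b^m is split off the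
    ratio gamma / b, so that both series run with the common ratio [gamma]. *)
Definition tilt (b : nat) (al be x : R) (s : nat -> nat) (m : nat) : R :=
  al * sin (ang b x s m) + be * (cos (ang b x s m) / INR b ^ m).

Lemma tilt_sqr (b : nat) (al be x : R) (s : nat -> nat) (m : nat) :
  al * al + be * be = 1 ->
  tilt b al be x s m ^ 2 <=
    sin (ang b x s m) ^ 2 + (/ INR b ^ m) ^ 2 * cos (ang b x s m) ^ 2.
Proof.
  intros H. unfold tilt, Rdiv. set (p := sin _). set (q := cos _ * _).
  replace (p ^ 2 + (/ INR b ^ m) ^ 2 * cos (ang b x s m) ^ 2)
    with ((al * al + be * be) * (p ^ 2 + q ^ 2)) by (rewrite H; unfold p, q; ring).
  (* Cauchy-Schwarz by Lagrange's identity: the defect is this square. *)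
  assert (h := pow2_ge_0 (al * q - be * p)). nra.
Qed.

Lemma inv_pow_bound (b m : nat) : (2 <= b)%nat -> 0 <= / INR b ^ m <= 1.
Proof.
  intros hb. assert (B : 2 <= INR b) by (apply (le_INR 2); auto).
  assert (P : 1 <= INR b ^ m) by (apply pow_R1_Rle; lra).
  split; [left; apply Rinv_0_lt_compat; lra|].
  rewrite <- Rinv_1. apply Rinv_le_contravar; lra.
Qed.

Lemma Rabs_le_of_sqr (y c : R) : 0 <= c -> y ^ 2 <= c ^ 2 -> Rabs y <= c.
Proof. intros Hc H. apply Rabs_le. split; nra. Qed.

Lemma tilt_le_1 (b : nat) (al be x : R) (s : nat -> nat) (m : nat) : (2 <= b)%nat ->
  al * al + be * be = 1 -> Rabs (tilt b al be x s m) <= 1.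
Proof.
  intros hb H. apply Rabs_le_of_sqr; [lra|].
  assert (h := tilt_sqr b al be x s m H). assert (I := inv_pow_bound b m hb).
  assert (E := sin2_cos2 (ang b x s m)). unfold Rsqr in E.
  set (d := / INR b ^ m) in *. assert (d ^ 2 <= 1) by nra.
  assert (0 <= cos (ang b x s m) ^ 2) by apply pow2_ge_0. nra.
Qed.

(* The vectors [(sin, cos / b^m)] have norm at most 1; projecting them all on one
   direction [(al, be)] couples the two tangency conditions without loss. *)
Lemma tangent_tilt (b : nat) (gamma al be x eps del : R) (s t : nat -> nat) :
  (2 <= b)%nat -> 0 <= gamma < 1 -> al * al + be * be = 1 -> tangent b gamma x eps del s t ->
  Rabs (tilt b al be x s 0 - tilt b al be x t 0) <= eps + del * INR b
    + gamma * (Rabs (tilt b al be x s 1) + Rabs (tilt b al be x t 1))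
    + gamma ^ 2 * (Rabs (tilt b al be x s 2) + Rabs (tilt b al be x t 2))
    + 2 * gamma ^ 3 / (1 - gamma).
Proof.
  intros hb Hg Hab T.
  assert (B : 2 <= INR b) by (apply (le_INR 2); auto).
  assert (Hr : 0 <= gamma / INR b < 1).
  { split; [apply Rdiv_le_0_compat; lra|]. apply Rlt_div_l; lra. }
  assert (T1 := tangent_sin_series _ _ _ _ _ _ _ Hg T).
  assert (T2 := tangent_cos_series _ _ _ _ _ _ _ hb Hg T).
  set (a1 := fun m => gamma ^ m * (sin (ang b x s m) - sin (ang b x t m))) in T1.
  set (a2 := fun m => (gamma / INR b) ^ m * (cos (ang b x s m) - cos (ang b x t m))) in T2.
  set (a := fun m => gamma ^ m * (tilt b al be x s m - tilt b al be x t m)).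
  assert (E : Series a = al * Series a1 + be * Series a2).
  { rewrite <- !Series_scal_l, <- Series_plus.
    - apply Series_ext. intros m. unfold a, a1, a2, tilt, Rdiv.
      rewrite Rpow_mult_distr, pow_inv. ring.
    - apply (geom_ex_series _ (Rabs al * 2) gamma Hg). intros m.
      replace (al * a1 m) with (al * 2 * (gamma ^ m * ((sin (ang b x s m) - sin (ang b x t m)) / 2)))
        by (unfold a1; field).
      replace (Rabs al * 2) with (Rabs (al * 2)) by (rewrite Rabs_mult, (Rabs_pos_eq 2); lra).
      apply Rabs_scaled_le; [apply pow_le; lra|].
      destruct (SIN_bound (ang b x s m)), (SIN_bound (ang b x t m)). lra.
    - apply (geom_ex_series _ (Rabs be * 2) (gamma / INR b) Hr). intros m.
      replace (be * a2 m) with (be * 2 * ((gamma / INR b) ^ m *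
        ((cos (ang b x s m) - cos (ang b x t m)) / 2))) by (unfold a2; field; lra).
      replace (Rabs be * 2) with (Rabs (be * 2)) by (rewrite Rabs_mult, (Rabs_pos_eq 2); lra).
      apply Rabs_scaled_le; [apply pow_le; lra|].
      destruct (COS_bound (ang b x s m)), (COS_bound (ang b x t m)). lra. }
  assert (A : Rabs (Series a) <= eps + del * INR b).
  { rewrite E. eapply Rle_trans; [apply Rabs_triang|]. rewrite !Rabs_mult.
    assert (Rabs al <= 1) by (apply Rabs_le; split; nra).
    assert (Rabs be <= 1) by (apply Rabs_le; split; nra).
    assert (h1 := Rabs_pos (Series a1)). assert (h2 := Rabs_pos (Series a2)). nra. }
  assert (D : forall m, Rabs (tilt b al be x s m - tilt b al be x t m)
    <= Rabs (tilt b al be x s m) + Rabs (tilt b al be x t m)).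
  { intros m. unfold Rminus. eapply Rle_trans; [apply Rabs_triang|]. rewrite Rabs_Ropp; lra. }
  assert (Ha : forall m, Rabs (a m) <= 2 * gamma ^ m).
  { intros m. unfold a. assert (h := pow_le _ m (proj1 Hg)).
    rewrite Rabs_mult, Rabs_pos_eq by auto. specialize (D m).
    assert (I1 := tilt_le_1 b al be x s m hb Hab).
    assert (I2 := tilt_le_1 b al be x t m hb Hab). nra. }
  (* Terms 1 and 2 stay explicit because the case [b = 6] needs a saving in one of them; only the
     terms from 3 on are bounded by 2 gamma^m. *)
  assert (H := geom_Series_tail a 2 gamma 2 Hg Ha). simpl sum_f_R0 in H.
  assert (A1 : Rabs (a 1%nat) <=
    gamma * (Rabs (tilt b al be x s 1) + Rabs (tilt b al be x t 1))).
  { unfold a. rewrite pow_1, Rabs_mult, Rabs_pos_eq by lra.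
    apply Rmult_le_compat_l; [lra | auto]. }
  assert (A2 : Rabs (a 2%nat) <=
    gamma ^ 2 * (Rabs (tilt b al be x s 2) + Rabs (tilt b al be x t 2))).
  { unfold a. rewrite Rabs_mult, Rabs_pos_eq by (apply pow_le; lra).
    apply Rmult_le_compat_l; [apply pow_le; lra | auto]. }
  replace (tilt b al be x s 0 - tilt b al be x t 0) with (a 0%nat) by (unfold a; simpl; ring).
  set (X := Series a) in *. set (R0 := 2 * gamma ^ 3 / (1 - gamma)) in *.
  apply Rabs_le. apply Rabs_le_between in H, A, A1, A2. lra.
Qed.

(** Modulo 2 pi, multiplication by [b] carries each angle to the preceding one. *)
Lemma ang_pred (b : nat) (x : R) (s : nat -> nat) (m : nat) : (2 <= b)%nat ->
  INR b * ang b x s (Datatypes.S m) = ang b x s m + 2 * INR (s (Datatypes.S m)) * PI.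
Proof.
  intros hb. assert (B : 2 <= INR b) by (apply (le_INR 2); auto).
  assert (INR b ^ m <> 0) by (apply pow_nonzero; lra).
  unfold ang, pref. simpl. field. split; lra.
Qed.

(** The Chebyshev polynomial T_6. *)
Lemma cos_6a (y : R) : cos (6 * y) = 32 * cos y ^ 6 - 48 * cos y ^ 4 + 18 * cos y ^ 2 - 1.
Proof.
  replace (6 * y) with (2 * (2 * y + y)) by ring.
  rewrite cos_2a_cos, cos_plus, sin_2a, cos_2a_cos.
  assert (E := sin2_cos2 y). unfold Rsqr in E.
  replace (2 * sin y * cos y * sin y) with (2 * cos y * (1 - cos y * cos y)) by (rewrite <- E; ring).
  ring.
Qed.

(* If [cos] is close to 0 at the angle [y] then it is close to -1 at [6 y]. *)
Lemma tilt_6 (al be x : R) (s : nat -> nat) : al * al + be * be = 1 ->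
  Rabs (tilt 6 al be x s 1) <= 99 / 100 \/ Rabs (tilt 6 al be x s 2) <= 99 / 100.
Proof.
  intros H.
  assert (E : cos (ang 6 x s 1) = cos (6 * ang 6 x s 2)).
  { assert (h := ang_pred 6 x s 1 ltac:(lia)).
    replace (INR 6) with 6 in h by (simpl; ring). rewrite h. now rewrite cos_period. }
  rewrite cos_6a in E.
  assert (h1 := tilt_sqr 6 al be x s 1 H). assert (h2 := tilt_sqr 6 al be x s 2 H).
  replace (INR 6) with 6 in h1, h2 by (simpl; ring).
  replace ((/ 6 ^ 1) ^ 2) with (/ 36) in h1 by field.
  replace ((/ 6 ^ 2) ^ 2) with (/ 1296) in h2 by field.
  assert (E1 := sin2_cos2 (ang 6 x s 1)). assert (E2 := sin2_cos2 (ang 6 x s 2)).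
  unfold Rsqr in E1, E2.
  set (c2 := cos (ang 6 x s 2)) in *. set (c1 := cos (ang 6 x s 1)) in *.
  (* If [c2^2 < 1/36], then T_6 gives [c1 <= 18/36 - 1 = -1/2], and the weight 1/36 on [c1^2] lowers
     the squared norm at index 1. Otherwise the squared norm at index 2 is at most 1 - (1 -
     1/1296)/36, which is below (99/100)^2. *)
  destruct (Rlt_le_dec (c2 ^ 2) (/ 36)) as [h|h].
  - left. apply Rabs_le_of_sqr; [lra|].
    assert (Hc : c1 <= - / 2).
    { rewrite E. set (z := c2 ^ 2) in *.
      replace (32 * c2 ^ 6 - 48 * c2 ^ 4 + 18 * z - 1) with (32 * z ^ 3 - 48 * z ^ 2 + 18 * z - 1)
        by (unfold z; ring).
      assert (0 <= z) by (unfold z; apply pow2_ge_0). nra. }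
    nra.
  - right. apply Rabs_le_of_sqr; [lra|]. nra.
Qed.

(** * The chord bound *)

(** Concavity of the sine: its mean slope on [0, t] is at least that on [t, c], because cosine
    decreases. *)
Lemma sin_chord (t c : R) : 0 <= t <= c -> c <= PI / 2 -> t * sin c <= c * sin t.
Proof.
  intros [H0 H1] H2. assert (HP := PI_RGT_0).
  destruct (Req_dec t 0) as [->|Ht0]; [rewrite sin_0; lra|].
  destruct (Req_dec t c) as [->|Htc]; [lra|].
  destruct (MVT_cor2 sin cos 0 t) as [u [Eu Hu]]; [lra | intros; apply derivable_pt_lim_sin|].
  destruct (MVT_cor2 sin cos t c) as [v [Ev Hv]]; [lra | intros; apply derivable_pt_lim_sin|].
  rewrite sin_0 in Eu.
  assert (cos v <= cos u) by (apply cos_decr_1; lra).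
  assert (E : sin t = cos u * t) by lra. assert (E' : sin c = cos u * t + cos v * (c - t)) by lra.
  rewrite E', E. assert (t * (c - t) >= 0) by nra. nra.
Qed.

(** The chord bound at pi D / b. The choices [c = PI / 2], [PI / 4] and [PI / 6] give the slopes 2,
    2 sqrt 2 and 3. *)
Lemma sin_PI_div_ge (b D : nat) (c : R) : (0 < b)%nat -> 0 < c <= PI / 2 ->
  PI * INR D <= c * INR b -> PI * sin c / c * (INR D / INR b) <= sin (PI * (INR D / INR b)).
Proof.
  intros hb Hc H. assert (B : 0 < INR b) by (apply lt_0_INR; auto).
  assert (HP := PI_RGT_0). assert (HD := pos_INR D).
  assert (Ht : PI * (INR D / INR b) <= c).
  { apply Rmult_le_reg_r with (INR b); auto.
    replace (PI * (INR D / INR b) * INR b) with (PI * INR D) by (field; lra). auto. }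
  assert (h := sin_chord (PI * (INR D / INR b)) c).
  apply Rmult_le_reg_l with c; [lra|].
  replace (c * (PI * sin c / c * (INR D / INR b))) with (PI * (INR D / INR b) * sin c) by (field; lra).
  apply h; [split|]; try lra.
  apply Rmult_le_pos; [lra | apply Rdiv_le_0_compat; lra].
Qed.

Lemma sin_sqr_ge_jordan (b D : nat) : (0 < b)%nat -> (2 * D <= b)%nat ->
  4 * INR D ^ 2 / INR b ^ 2 <= sin (PI * (INR D / INR b)) ^ 2.
Proof.
  intros hb HD. assert (HP := PI_RGT_0). assert (B : 0 < INR b) by (apply lt_0_INR; auto).
  assert (H := sin_PI_div_ge b D (PI / 2) hb ltac:(lra)).
  rewrite sin_PI2 in H.
  apply le_INR in HD. rewrite mult_INR in HD. simpl INR in HD at 1.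
  specialize (H ltac:(nra)).
  replace (PI * 1 / (PI / 2) * (INR D / INR b)) with (2 * INR D / INR b) in H by (field; lra).
  replace (4 * INR D ^ 2 / INR b ^ 2) with ((2 * INR D / INR b) ^ 2) by (field; lra).
  apply pow_incr. split; auto. apply Rdiv_le_0_compat; auto. assert (h := pos_INR D); lra.
Qed.

(** For [D = 1] Jordan's inequality would give only 4 / b^2; since pi / b <= pi / 4, the chord up to
    pi / 4 gives 8 / b^2. For [D >= 2] Jordan's inequality already gives 16 / b^2. *)
Lemma sin_sqr_ge_8 (b D : nat) : (4 <= b)%nat -> (1 <= D)%nat -> (2 * D <= b)%nat ->
  8 / INR b ^ 2 <= sin (PI * (INR D / INR b)) ^ 2.
Proof.
  intros hb HD HDb. assert (HP := PI_RGT_0).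
  assert (B : 4 <= INR b) by (replace 4 with (INR 4) by (simpl; ring); apply le_INR; auto).
  assert (B2 : 0 < / INR b ^ 2) by (apply Rinv_0_lt_compat; nra).
  destruct (Nat.eq_dec D 1) as [->|N].
  - assert (H := sin_PI_div_ge b 1 (PI / 4) ltac:(lia) ltac:(lra) ltac:(simpl; nra)).
    rewrite sin_PI4 in H. simpl (INR 1) in *.
    assert (Hs : sqrt 2 <> 0) by (assert (h := Rlt_sqrt2_0); lra).
    replace (PI * (1 / sqrt 2) / (PI / 4) * (1 / INR b)) with (4 / sqrt 2 / INR b) in H
      by (field; split; lra).
    replace (8 / INR b ^ 2) with ((4 / sqrt 2 / INR b) ^ 2).
    + apply pow_incr. split; auto. assert (h := Rlt_sqrt2_0).
      repeat apply Rdiv_le_0_compat; lra.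
    + replace ((4 / sqrt 2 / INR b) ^ 2) with (16 / sqrt 2 ^ 2 / INR b ^ 2) by (field; split; lra).
      rewrite pow2_sqrt by lra. field; lra.
  - eapply Rle_trans; [|apply sin_sqr_ge_jordan; lia].
    assert (2 <= INR D) by (apply (le_INR 2); lia).
    unfold Rdiv. apply Rmult_le_compat_r; [lra|]. nra.
Qed.

(** The chord up to pi / 6 settles [d = 1]; monotonicity up to the middle and the symmetry y -> pi -
    y reduce every other [d] to it. *)
Lemma sin_PI_div_ge_3 (b : nat) (d : R) : (6 <= b)%nat -> 1 <= d <= INR b - 1 ->
  3 / INR b <= sin (PI * (d / INR b)).
Proof.
  intros hb Hd. assert (HP := PI_RGT_0).
  assert (B : 6 <= INR b) by (replace 6 with (INR 6) by (simpl; ring); apply le_INR; auto).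
  assert (H := sin_PI_div_ge b 1 (PI / 6) ltac:(lia) ltac:(lra) ltac:(simpl; nra)).
  rewrite sin_PI6 in H. simpl (INR 1) in H.
  replace (PI * (1 / 2) / (PI / 6) * (1 / INR b)) with (3 / INR b) in H by (field; lra).
  eapply Rle_trans; [exact H|].
  assert (K : forall y, 1 <= y <= INR b / 2 ->
    sin (PI * (1 / INR b)) <= sin (PI * (y / INR b))).
  { intros y Hy.
    assert (1 / INR b <= y / INR b)
      by (unfold Rdiv; apply Rmult_le_compat_r; [left; apply Rinv_0_lt_compat|]; lra).
    assert (0 < 1 / INR b) by (apply Rdiv_lt_0_compat; lra).
    assert (y / INR b <= / 2) by (apply Rle_div_l; lra).
    apply sin_incr_1; nra. }
  destruct (Rle_lt_dec d (INR b / 2)); [apply K; lra|].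
  replace (PI * (d / INR b)) with (PI - PI * ((INR b - d) / INR b)) by (field; lra).
  rewrite sin_PI_x. apply K; lra.
Qed.

Lemma ang_concat (b k : nat) (x : R) (u : nat -> nat) : (2 <= b)%nat -> (k < b)%nat ->
  ang b x (concat b 1 k u) 0 = 2 * PI * ((x + INR k) / INR b).
Proof.
  intros hb Hk.
  assert (E : concat b 1 k u 0 = k).
  { change (digit b k 0 = k). unfold digit.
    now rewrite Nat.pow_0_r, Nat.div_1_r, Nat.mod_small. }
  unfold ang, pref, sum_f_R0. rewrite E. simpl. now rewrite !Rmult_1_r.
Qed.

Lemma isword_1 (b k : nat) : isword b 1 k <-> (k < b)%nat.
Proof. unfold isword. now rewrite Nat.pow_1_r. Qed.

(** The first vectors lie on the unit circle at angles w + d and w - d, and their difference is 2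
    sin d times the unit vector (cos w, - sin w). Projecting on that direction preserves the full
    chord length. *)
Lemma inE_chord (b : nat) (gamma x eps del : R) (k l : nat) :
  (2 <= b)%nat -> 0 <= gamma < 1 -> inE b gamma 1 x eps del k l ->
  exists al be s t, al * al + be * be = 1 /\
  2 * Rabs (sin (PI * ((INR k - INR l) / INR b))) <= eps + del * INR b
    + gamma * (Rabs (tilt b al be x s 1) + Rabs (tilt b al be x t 1))
    + gamma ^ 2 * (Rabs (tilt b al be x s 2) + Rabs (tilt b al be x t 2))
    + 2 * gamma ^ 3 / (1 - gamma).
Proof.
  intros hb Hg [Hk [Hl [u [v [_ [_ T]]]]]]. apply (proj1 (isword_1 _ _)) in Hk, Hl.
  set (s := concat b 1 k u) in *. set (t := concat b 1 l v) in *.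
  set (w := (ang b x s 0 + ang b x t 0) / 2).
  exists (cos w), (- sin w), s, t.
  assert (Hab : cos w * cos w + - sin w * - sin w = 1)
    by (assert (h := sin2_cos2 w); unfold Rsqr in h; lra).
  split; auto.
  eapply Rle_trans; [|apply (tangent_tilt b gamma (cos w) (- sin w) x eps del s t hb Hg Hab T)].
  set (d := PI * ((INR k - INR l) / INR b)).
  assert (B : 2 <= INR b) by (apply (le_INR 2); auto).
  assert (Ed : ang b x s 0 - ang b x t 0 = 2 * d)
    by (unfold s, t, d; rewrite !ang_concat by auto; field; lra).
  unfold tilt. simpl pow. unfold Rdiv. rewrite Rinv_1, !Rmult_1_r.
  replace (ang b x s 0) with (w + d) by (unfold w; lra).
  replace (ang b x t 0) with (w - d) by (unfold w; lra).
  rewrite sin_plus, cos_plus, sin_minus, cos_minus.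
  match goal with |- _ <= Rabs ?y => replace y with (2 * sin d * (cos w * cos w + - sin w * - sin w)) by ring end.
  rewrite Hab, Rmult_1_r, Rabs_mult, (Rabs_pos_eq 2); lra.
Qed.

(** Distinct branches have chord at least 6 / b, while the tails allow at most 2 gamma / (1 - gamma)
    <= 4 / (b - 2), up to the tolerances. For [b >= 7] the gap is positive; for [b = 6] both sides
    can equal 1, and [tilt_6] supplies the strictness. *)
Lemma inE_diagonal (b : nat) (gamma : R) :
  (6 <= b)%nat -> / INR b < gamma < 1 -> gamma * INR b <= 2 ->
  exists eps, 0 < eps /\ forall x k l, inE b gamma 1 x eps eps k l -> k = l.
Proof.
  intros hb Hg Hgb.
  assert (B : 6 <= INR b) by (replace 6 with (INR 6) by (simpl; ring); apply le_INR; auto).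
  assert (G0 : 0 < gamma) by (assert (0 < / INR b) by (apply Rinv_0_lt_compat; lra); lra).
  assert (Sk : forall k l, (k < b)%nat -> (l < b)%nat -> k <> l ->
    3 / INR b <= Rabs (sin (PI * ((INR k - INR l) / INR b)))).
  { assert (W : forall k l, (k < b)%nat -> (l < k)%nat ->
      3 / INR b <= sin (PI * ((INR k - INR l) / INR b))).
    { intros k l Hk Hl. apply sin_PI_div_ge_3; auto.
      apply le_INR in Hk, Hl. rewrite S_INR in Hk, Hl. assert (h := pos_INR l). lra. }
    intros k l Hk Hl N. destruct (le_lt_dec k l).
    - replace (PI * ((INR k - INR l) / INR b)) with (- (PI * ((INR l - INR k) / INR b)))
        by (field; lra).
      rewrite sin_neg, Rabs_Ropp. eapply Rle_trans; [apply (W l k); [exact Hl|lia] | apply Rle_abs].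
    - eapply Rle_trans; [apply (W k l); auto | apply Rle_abs]. }
  assert (Q : gamma / (1 - gamma) <= 2 / (INR b - 2)).
  { apply Rmult_le_reg_r with ((1 - gamma) * (INR b - 2)); [nra|].
    replace (gamma / (1 - gamma) * ((1 - gamma) * (INR b - 2))) with (gamma * INR b - 2 * gamma)
      by (field; lra).
    replace (2 / (INR b - 2) * ((1 - gamma) * (INR b - 2))) with (2 - 2 * gamma) by (field; lra).
    lra. }
  assert (Q3 : 2 * gamma + 2 * gamma ^ 2 + 2 * gamma ^ 3 / (1 - gamma) = 2 * (gamma / (1 - gamma)))
    by (field; lra).
  destruct (Nat.eq_dec b 6) as [->|N].
  - replace (INR 6) with 6 in * by (simpl; ring).
    (* The two branches together save at least 2 gamma^2 / 100 > 1/1800, as gamma > 1/6; the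
       tolerances cost only 7/20000. *)
    exists (/ 20000). split; [lra|]. intros x k l Hin.
    apply NNPP; intros N.
    assert (Hw := Hin). destruct Hw as [Hk [Hl _]]. apply (proj1 (isword_1 _ _)) in Hk, Hl.
    specialize (Sk k l Hk Hl N).
    destruct (inE_chord 6 gamma x _ _ k l ltac:(lia) ltac:(lra) Hin) as [al [be [s [t [Hab H]]]]].
    replace (INR 6) with 6 in * by (simpl; ring).
    assert (T : forall s, gamma * Rabs (tilt 6 al be x s 1) + gamma ^ 2 * Rabs (tilt 6 al be x s 2)
      <= gamma + gamma ^ 2 - gamma ^ 2 / 100).
    { intros r. assert (I1 := tilt_le_1 6 al be x r 1 ltac:(lia) Hab).
      assert (I2 := tilt_le_1 6 al be x r 2 ltac:(lia) Hab).
      assert (G2 : 0 < gamma ^ 2 <= gamma) by nra.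
      destruct (tilt_6 al be x r Hab) as [I|I]; nra. }
    assert (T1 := T s). assert (T2 := T t). nra.
  - assert (B7 : 7 <= INR b)
      by (replace 7 with (INR 7) by (simpl; ring); apply le_INR; lia).
    set (g := 6 / INR b - 4 / (INR b - 2)).
    assert (Hgap : 0 < g).
    { unfold g. replace (6 / INR b - 4 / (INR b - 2)) with (2 * (INR b - 6) / (INR b * (INR b - 2)))
        by (field; lra). apply Rdiv_lt_0_compat; nra. }
    (* Chosen so that the total tolerance eps (1 + b) is half of the gap. *)
    exists (g / (2 * (1 + INR b))). split; [apply Rdiv_lt_0_compat; lra|]. intros x k l Hin.
    apply NNPP; intros N'.
    assert (Hw := Hin). destruct Hw as [Hk [Hl _]]. apply (proj1 (isword_1 _ _)) in Hk, Hl.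
    specialize (Sk k l Hk Hl N').
    destruct (inE_chord b gamma x _ _ k l ltac:(lia) ltac:(lra) Hin) as [al [be [s [t [Hab H]]]]].
    assert (E : g / (2 * (1 + INR b)) + g / (2 * (1 + INR b)) * INR b = g / 2) by (field; lra).
    assert (G2 : 0 < gamma ^ 2) by nra.
    assert (I1 := tilt_le_1 b al be x s 1 ltac:(lia) Hab).
    assert (I2 := tilt_le_1 b al be x s 2 ltac:(lia) Hab).
    assert (I3 := tilt_le_1 b al be x t 1 ltac:(lia) Hab).
    assert (I4 := tilt_le_1 b al be x t 2 ltac:(lia) Hab).
    assert (2 * (3 / INR b) = 6 / INR b) by (field; lra).
    assert (2 * (2 / (INR b - 2)) = 4 / (INR b - 2)) by (field; lra).
    assert (gamma * (Rabs (tilt b al be x s 1) + Rabs (tilt b al be x t 1)) <= 2 * gamma) by nra.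
    assert (gamma ^ 2 * (Rabs (tilt b al be x s 2) + Rabs (tilt b al be x t 2)) <= 2 * gamma ^ 2)
      by nra.
    unfold g in *. lra.
Qed.

(** * Points in a cosine window *)

Lemma cos_Lipschitz (u v : R) : Rabs (cos u - cos v) <= Rabs (u - v).
Proof.
  destruct (MVT_abs cos (fun y => - sin y) v u) as [c [E _]];
    [intros; apply derivable_pt_lim_cos|].
  rewrite E, Rabs_Ropp. assert (h := Rabs_pos (u - v)).
  assert (Rabs (sin c) <= 1) by (apply Rabs_le; apply SIN_bound). nra.
Qed.

Definition cosw (b : nat) (x : R) (l : nat) : R := cos (2 * PI * ((x + INR l) / INR b)).

Lemma inE_cos (b : nat) (gamma x eps del : R) (k l : nat) :
  (2 <= b)%nat -> 0 <= gamma < 1 -> inE b gamma 1 x eps del k l ->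
  Rabs (cosw b x k - cosw b x l) <= 2 * (gamma / (INR b - gamma)) + del * INR b.
Proof.
  intros hb Hg [Hk [Hl [u [v [_ [_ T]]]]]]. apply (proj1 (isword_1 _ _)) in Hk, Hl.
  apply (tangent_cos_first b gamma x eps del _ _ hb Hg) in T.
  now rewrite !ang_concat in T.
Qed.

(** Take a level where the maximum has stabilized and the intervals are short. The [m] partners of
    an extremal [k] may be tangent to it at different points of one interval; the Lipschitz bound
    moves all of them to its left endpoint [x]. *)
Lemma e_window (b m : nat) (gamma eta : R) :
  (2 <= b)%nat -> 0 <= gamma < 1 -> e b gamma 1 = INR m -> (0 < m)%nat -> 0 < eta ->
  exists x k, 0 <= x <= 1 /\ (k < b)%nat /\
    (m <= ncount b (fun l =>
       Rabs (cosw b x k - cosw b x l) <= 2 * (gamma / (INR b - gamma)) + eta)%R)%nat.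
Proof.
  intros hb Hg Em Hm Heta.
  assert (B : 2 <= INR b) by (apply (le_INR 2); auto).
  assert (HP := PI_RGT_0).
  destruct (e_eventually b gamma 1 hb) as [m' [N [Em' HN]]].
  rewrite Em in Em'. apply INR_eq in Em'. subst m'.
  destruct (pow_tail_eventually_small (4 * PI) (/ INR b)) with (eps := eta / 2) as [N' HN'];
    [split; [left; apply Rinv_0_lt_compat; lra | rewrite <- Rinv_1; apply Rinv_lt_contravar; lra]
    | lra |].
  set (p := Nat.max N N').
  specialize (HN p (Nat.le_max_l _ _)). specialize (HN' p (Nat.le_max_r _ _)).
  destruct (nmax_attained (Nat.pow b p) (fun k => eJ b gamma 1 (cell b p k))) as [j [Hj Ej]];
    [rewrite HN; auto|].
  rewrite HN in Ej. unfold eJ in Ej.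
  match type of Ej with nmax ?n ?f = _ =>
    destruct (nmax_attained n f) as [k [Hk Ek]]; [rewrite Ej; auto|] end.
  rewrite Ej in Ek. clear Ej. rewrite Nat.pow_1_r in Hk.
  assert (P : 0 < INR b ^ p) by (apply pow_lt; lra).
  exists (INR j / INR b ^ p), k. split; [|split]; auto.
  - split; [apply Rdiv_le_0_compat; [apply pos_INR | auto]|].
    apply Rle_div_l; auto. rewrite Rmult_1_l, <- pow_INR. left; apply lt_INR; auto.
  - rewrite <- Ek. rewrite Nat.pow_1_r. apply ncount_le. intros l Hl [_ [_ H]].
    (* This [del] contributes eta / 2; the other half of [eta] pays for moving both cosines from [y]
       to [x]. *)
    destruct (H 1 (eta / (2 * INR b))) as [y [[Hy1 Hy2] Hin]];
      [lra | apply Rdiv_lt_0_compat; lra|].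
    apply inE_cos in Hin; auto.
    set (x := INR j / INR b ^ p) in *.
    assert (Hxy : 0 <= y - x <= / INR b ^ p)
      by (unfold x in *; unfold Rdiv in *; rewrite Rmult_plus_distr_r in Hy2; lra).
    assert (L : forall i, Rabs (cosw b x i - cosw b y i) <= PI * / INR b ^ p).
    { intros i. unfold cosw. eapply Rle_trans; [apply cos_Lipschitz|].
      replace (2 * PI * ((x + INR i) / INR b) - 2 * PI * ((y + INR i) / INR b))
        with (- (PI * ((y - x) * (2 / INR b)))) by (field; lra).
      assert (0 < 2 / INR b <= 1)
        by (split; [apply Rdiv_lt_0_compat; lra | apply Rle_div_l; lra]).
      rewrite Rabs_Ropp, Rabs_pos_eq by (apply Rmult_le_pos; nra).
      apply Rmult_le_compat_l; nra. }
    rewrite pow_inv in HN'.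
    replace (eta / (2 * INR b) * INR b) with (eta / 2) in Hin by (field; lra).
    assert (L1 := L k). assert (L2 := L l).
    assert (0 < / INR b ^ p) by (apply Rinv_0_lt_compat; auto).
    apply Rabs_le_between in L1, L2, Hin. apply Rabs_le. nra.
Qed.

(** The difference is 2 sin w sin d, with midpoint w and half-distance d; since d <= w <= pi - d,
    sin w >= sin d. *)
Lemma cos_diff_ge (t t' : R) : 0 <= t <= t' -> t' <= PI ->
  2 * sin ((t' - t) / 2) ^ 2 <= cos t - cos t'.
Proof.
  intros H1 H2. assert (HP := PI_RGT_0).
  set (d := (t' - t) / 2). set (w := (t + t') / 2).
  replace t with (w - d) by (unfold w, d; lra). replace t' with (w + d) by (unfold w, d; lra).
  rewrite cos_minus, cos_plus.
  assert (Hd : d <= w <= PI - d) by (unfold d, w; lra).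
  assert (D0 : 0 <= d <= PI / 2) by (unfold d; lra).
  assert (0 <= sin d) by (apply sin_ge_0; lra).
  assert (sin d <= sin w).
  { destruct (Rle_lt_dec w (PI / 2)); [apply sin_incr_1; lra|].
    replace (sin w) with (sin (PI - w)) by apply sin_PI_x. apply sin_incr_1; lra. }
  nra.
Qed.

(* Two of the points [x + l], [x + l'] on the same half of the circle, where cosine is
   monotone. *)
Lemma half_circle_gap (b l l' : nat) (x : R) : (0 < b)%nat -> 0 <= x <= 1 ->
  (l <= l' < b)%nat -> x + INR l' <= INR b / 2 \/ INR b / 2 <= x + INR l ->
  (2 * (l' - l) <= b)%nat /\
  2 * sin (PI * (INR (l' - l) / INR b)) ^ 2 <= Rabs (cosw b x l - cosw b x l').
Proof.
  intros hb Hx Hl Hs. assert (HP := PI_RGT_0).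
  assert (B : 0 < INR b) by (apply lt_0_INR; auto).
  assert (E := minus_INR l' l ltac:(lia)).
  assert (L0 := pos_INR l). assert (L1 : INR l <= INR l') by (apply le_INR; lia).
  assert (L2 : INR l' + 1 <= INR b) by (rewrite <- S_INR; apply le_INR; lia).
  split.
  - apply INR_le. rewrite mult_INR, E. simpl (INR 2). lra.
  - assert (A : forall y, 2 * PI * (y / INR b) = PI * (2 * y / INR b)) by (intros; field; lra).
    assert (Eh : PI * (INR (l' - l) / INR b)
      = (2 * PI * ((x + INR l') / INR b) - 2 * PI * ((x + INR l) / INR b)) / 2)
      by (rewrite E; field; lra).
    rewrite Eh. unfold cosw.
    assert (M : forall y z, y <= z -> y / INR b <= z / INR b)
      by (intros; unfold Rdiv; apply Rmult_le_compat_r;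
          [left; apply Rinv_0_lt_compat|]; lra).
    assert (M0 := M 0 (x + INR l) ltac:(lra)). assert (M1 := M _ _ (Rplus_le_compat_l x _ _ L1)).
    assert (M2 := M (x + INR l') (INR b) ltac:(lra)).
    replace (0 / INR b) with 0 in M0 by (field; lra).
    replace (INR b / INR b) with 1 in M2 by (field; lra).
    assert (M3 : (x + INR l') / INR b <= / 2 \/ / 2 <= (x + INR l) / INR b).
    { destruct Hs as [Hs|Hs]; [left | right]; apply M in Hs;
        replace (INR b / 2 / INR b) with (/ 2) in Hs by (field; lra); auto. }
    set (t := (x + INR l) / INR b) in *. set (t' := (x + INR l') / INR b) in *.
    destruct M3 as [M3|M3].
    + eapply Rle_trans; [apply cos_diff_ge; nra | apply Rle_abs].
    (* On the second half, a shift by pi flips the sign of cosine and reduces to the first half. *)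
    + replace (cos (2 * PI * t) - cos (2 * PI * t'))
        with (- (cos (2 * PI * t - PI) - cos (2 * PI * t' - PI)))
        by (rewrite !cos_minus, cos_PI, sin_PI; ring).
      rewrite Rabs_Ropp.
      replace (2 * PI * t' - 2 * PI * t) with ((2 * PI * t' - PI) - (2 * PI * t - PI)) by ring.
      eapply Rle_trans; [apply cos_diff_ge; nra | apply Rle_abs].
Qed.

Lemma same_half (b l l' : nat) (x : R) :
  (x + INR l <= INR b / 2 <-> x + INR l' <= INR b / 2) ->
  x + INR l' <= INR b / 2 \/ INR b / 2 <= x + INR l.
Proof.
  intros H. destruct (Rle_lt_dec (x + INR l) (INR b / 2)); [left; tauto | right; lra].
Qed.

(** One half of the circle holds at least half of the [m] points, so two of them have indices at
    least (m - 1) / 2 apart. Both cosines are within [d] of that of [k], hence within 2 d of each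
    other. *)
Lemma window_spread (b m k : nat) (x d : R) : (0 < b)%nat -> 0 <= x <= 1 -> (0 < m)%nat ->
  (m <= ncount b (fun l => Rabs (cosw b x k - cosw b x l) <= d)%R)%nat ->
  exists D, (2 * D <= b)%nat /\ (m <= 2 * D + 2)%nat /\
    sin (PI * (INR D / INR b)) ^ 2 <= d.
Proof.
  intros hb Hx Hm H.
  set (P := fun l => Rabs (cosw b x k - cosw b x l) <= d) in H.
  set (Q := fun l => x + INR l <= INR b / 2).
  assert (K : exists l l', (l' < b)%nat /\ P l /\ P l' /\ (l + (m - 1) / 2 <= l')%nat /\ (Q l <-> Q l')).
  { rewrite (ncount_split b P Q) in H.
    assert (G : (2 * ((m - 1) / 2) <= m - 1)%nat) by (apply Nat.Div0.mul_div_le).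
    destruct (le_lt_dec (ncount b (fun l => P l /\ Q l)) ((m - 1) / 2)) as [h|h].
    - destruct (ncount_spread b ((m - 1) / 2) (fun l => P l /\ ~ Q l)) as [l [l' W]]; [lia|].
      exists l, l'; tauto.
    - destruct (ncount_spread _ _ _ h) as [l [l' W]]. exists l, l'; tauto. }
  destruct K as [l [l' [Hl' [Pl [Pl' [HD HQ]]]]]].
  assert (G : (m - 1 < 2 * Datatypes.S ((m - 1) / 2))%nat) by (apply Nat.mul_succ_div_gt; lia).
  destruct (half_circle_gap b l l' x hb Hx) as [G1 G2]; [lia | apply same_half; auto; lia|].
  exists (l' - l)%nat. split; [|split]; auto; [lia|].
  unfold P in Pl, Pl'. apply Rabs_le_between in Pl, Pl'.
  assert (Rabs (cosw b x l - cosw b x l') <= 2 * d) by (apply Rabs_le; lra). lra.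
Qed.

(** Sharper because the center [k] is itself one of the points. A second point on its half is within
    [d], not 2 d, of it; otherwise three points lie on the other half and spread over at least 2
    indices. *)
Lemma window_spread_4 (b k : nat) (x d : R) : (0 < b)%nat -> 0 <= x <= 1 -> (k < b)%nat ->
  (4 <= ncount b (fun l => Rabs (cosw b x k - cosw b x l) <= d)%R)%nat ->
  exists D, (2 * D <= b)%nat /\
    ((1 <= D)%nat /\ sin (PI * (INR D / INR b)) ^ 2 <= d / 2 \/
     (2 <= D)%nat /\ sin (PI * (INR D / INR b)) ^ 2 <= d).
Proof.
  intros hb Hx Hk H.
  set (P := fun l => Rabs (cosw b x k - cosw b x l) <= d) in H.
  set (Q := fun l => x + INR l <= INR b / 2).
  rewrite (ncount_split b P (fun l => Q l <-> Q k)) in H.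
  destruct (le_lt_dec (ncount b (fun l => P l /\ (Q l <-> Q k))) 1) as [h|h].
  - destruct (ncount_spread b 2 (fun l => P l /\ ~ (Q l <-> Q k))) as [l [l' [Hl' [[Pl Ql] [[Pl' Ql'] HD]]]]];
      [lia|].
    destruct (half_circle_gap b l l' x hb Hx) as [G1 G2]; [lia | apply same_half|].
    { fold (Q l) (Q l'). destruct (classic (Q l)), (classic (Q l')), (classic (Q k)); tauto. }
    exists (l' - l)%nat. split; auto. right. split; [lia|].
    unfold P in Pl, Pl'. apply Rabs_le_between in Pl, Pl'.
    assert (Rabs (cosw b x l - cosw b x l') <= 2 * d) by (apply Rabs_le; lra). lra.
  - destruct (ncount_spread _ _ _ h) as [i [i' [Hi' [[Pi Qi] [[Pi' Qi'] HD]]]]].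
    assert (K : exists l, (l < b)%nat /\ l <> k /\ P l /\ (Q l <-> Q k)).
    { destruct (Nat.eq_dec i k) as [->|N]; [exists i' | exists i]; repeat split; auto; try tauto; lia. }
    destruct K as [l [Hl [N [Pl Ql]]]].
    destruct (le_lt_dec l k).
    + destruct (half_circle_gap b l k x hb Hx) as [G1 G2]; [lia | apply same_half; auto|].
      exists (k - l)%nat. split; auto. left. split; [lia|].
      unfold P in Pl. rewrite Rabs_minus_sym in Pl. lra.
    + destruct (half_circle_gap b k l x hb Hx) as [G1 G2];
        [lia | apply same_half; symmetry; auto|].
      exists (l - k)%nat. split; auto. left. split; [lia|]. unfold P in Pl. lra.
Qed.

(** Everything is scaled by X = b^2. The window bounds the scaled squared sine by 2 r X + 1/10,
    where r X = gamma b X / (X - gamma b) is at most linear in [m], while the spread of [m] points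
    forces growth like 4 D^2. *)
Lemma e_le_2 (b m : nat) (gamma : R) : (4 <= b)%nat -> / INR b < gamma < 1 ->
  e b gamma 1 = INR m -> gamma * INR b <= INR m -> (m <= 2)%nat.
Proof.
  intros hb Hg Em Hgb. destruct (le_lt_dec m 2) as [|Hm]; auto. exfalso.
  assert (B : 4 <= INR b) by (replace 4 with (INR 4) by (simpl; ring); apply le_INR; auto).
  assert (G0 : 0 < gamma) by (assert (0 < / INR b) by (apply Rinv_0_lt_compat; lra); lra).
  set (eta := / (10 * INR b ^ 2)).
  assert (He : 0 < eta) by (apply Rinv_0_lt_compat; nra).
  destruct (e_window b m gamma eta ltac:(lia) ltac:(lra) Em ltac:(lia) He)
    as [x [k [Hx [Hk Hn]]]].
  set (r := gamma / (INR b - gamma)) in *.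
  assert (Er : r * (INR b - gamma) = gamma) by (unfold r; field; lra).
  assert (r0 : 0 < r) by (apply Rdiv_lt_0_compat; lra).
  assert (Scale : forall c y, c / INR b ^ 2 <= y -> c <= y * INR b ^ 2).
  { intros c y h. apply Rle_div_l; [nra | exact h]. }
  assert (Ee : eta * INR b ^ 2 = / 10) by (unfold eta; field; lra).
  set (X := INR b ^ 2) in *. assert (HX : 16 <= X) by (unfold X; nra).
  assert (RX : r * (X - gamma * INR b) = gamma * INR b)
    by (unfold X; rewrite <- Er at 2; ring).
  destruct (window_spread b m k x _ ltac:(lia) Hx ltac:(lia) Hn) as [D [HD [HmD Hs]]].
  assert (HJ := sin_sqr_ge_jordan b D ltac:(lia) HD).
  assert (J4 : 4 * INR D ^ 2 <= (2 * r + eta) * X) by (apply Scale; unfold X in *; lra).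
  assert (J8 : 8 <= (2 * r + eta) * X).
  { apply Scale. unfold X. eapply Rle_trans; [apply (sin_sqr_ge_8 b D)|]; auto; lia. }
  destruct (Nat.eq_dec m 3) as [->|N3]; [|destruct (Nat.eq_dec m 4) as [->|N4]].
  (* With X >= 16, 2 r X <= 96/13, so 2 r X + 1/10 < 8. *)
  - simpl INR in Hgb. assert (r * (X - 3) <= 3) by nra. nra.
  (* Now r X <= 16/3: half of the window stays below 8, and all of it below 16. *)
  - simpl INR in Hgb. assert (r * (X - 4) <= 4) by nra.
    destruct (window_spread_4 b k x _ ltac:(lia) Hx Hk Hn) as [D' [HD' [[K1 K2]|[K1 K2]]]].
    + assert (8 <= (2 * r + eta) / 2 * X); [|nra].
      apply Scale. unfold X. eapply Rle_trans; [apply (sin_sqr_ge_8 b D')|]; auto.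
    + assert (4 * INR D' ^ 2 <= (2 * r + eta) * X).
      { apply Scale. unfold X. eapply Rle_trans; [apply (sin_sqr_ge_jordan b D')|]; auto; lia. }
      assert (2 <= INR D') by (apply (le_INR 2); auto). nra.
  - assert (Hmb : (m <= b)%nat).
    { eapply Nat.le_trans; [exact Hn|].
      eapply Nat.le_trans; [apply (ncount_ge_bound _ 0); intros; lia | lia]. }
    assert (D2 : 2 <= INR D) by (apply (le_INR 2); lia).
    apply le_INR in Hmb, HmD. rewrite plus_INR, mult_INR in HmD. simpl (INR 2) in HmD.
    assert (H5 : 5 <= INR m) by (replace 5 with (INR 5) by (simpl; ring); apply le_INR; lia).
    (* As [b >= 5], X - b >= 4 X / 5. With m <= 2 D + 2 this leaves 4 D^2 <= 5 D + 5 + 1/10, which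
       is false for [D >= 2]. *)
    assert (RX' : r * X <= 5 / 4 * INR m).
    { assert (r * (X - INR b) <= INR m) by nra.
      assert (X - INR b >= 4 / 5 * X) by (unfold X; nra). nra. }
    nra.
Qed.

(** * Three branches *)

Lemma sin_PI_div_3_sqr : sin (PI * (1 / 3)) ^ 2 = 3 / 4.
Proof.
  replace (PI * (1 / 3)) with (PI / 3) by field. rewrite sin_PI3.
  replace ((sqrt 3 / 2) ^ 2) with (sqrt 3 ^ 2 / 4) by field. now rewrite pow2_sqrt by lra.
Qed.

(** Two of the three branches share a half circle, so 3/4 = sin(pi/3)^2 <= 2 gamma / (3 - gamma) +
    1/1000. This makes 3 gamma about 27/11 or more, above 1 + sqrt 2 < 2.415. *)
Lemma e_3_gamma (m : nat) (gamma : R) : 0 < gamma < 1 -> e 3 gamma 1 = INR m -> (3 <= m)%nat ->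
  1 + sqrt 2 < 3 * gamma.
Proof.
  intros Hg Em Hm.
  destruct (e_window 3 m gamma (/ 1000) ltac:(lia) ltac:(lra) Em ltac:(lia) ltac:(lra))
    as [x [k [Hx [Hk Hn]]]].
  destruct (window_spread 3 m k x _ ltac:(lia) Hx ltac:(lia) Hn) as [D [HD [HmD Hs]]].
  assert (D = 1%nat) as -> by lia.
  replace (INR 1) with 1 in Hs by reflexivity.
  replace (INR 3) with 3 in Hs by (simpl; ring). rewrite sin_PI_div_3_sqr in Hs.
  set (r := gamma / (3 - gamma)) in *.
  assert (Er : r * (3 - gamma) = gamma) by (unfold r; field; lra).
  assert (Hq : sqrt 2 < 283 / 200).
  { rewrite <- (sqrt_Rsqr (283 / 200)) by lra. apply sqrt_lt_1; unfold Rsqr; lra. }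
  nra.
Qed.

(* Balances a star graph: row sums are [1 + 2 / sqrt 2] at the center [c] and
   [1 + sqrt 2] at the two leaves. *)
Definition star (c u v : nat) : R :=
  if Nat.eqb u v then 1 else if Nat.eqb u c then / sqrt 2 else if Nat.eqb v c then sqrt 2 else 0.

Lemma star_sum (c u : nat) : (c < 3)%nat -> (u < 3)%nat -> rsum 3 (star c u) = 1 + sqrt 2.
Proof.
  intros Hc Hu. assert (h := Rlt_sqrt2_0).
  assert (E : / sqrt 2 = sqrt 2 / 2).
  { rewrite <- (sqrt_sqrt 2) at 3 by lra. field. lra. }
  destruct c as [|[|[|c]]]; [| | | lia]; (destruct u as [|[|[|u]]]; [| | | lia]);
    unfold star; simpl; rewrite ?E; lra.
Qed.

(* For [x <= 1/2] the branches 0 and 1 are never nearly tangent, for [x >= 1/2] the branches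
   1 and 2 are not, so the tangency graph lies in a star. *)
Lemma sigma_3 (gamma : R) : 0 <= gamma < 1 ->
  exists w V, weight w /\ admissible 3 gamma 1 V /\ ess_le (Sig 3 1 V w) (1 + sqrt 2).
Proof.
  intros Hg. assert (h2 := Rlt_sqrt2_0).
  exists (fun _ => 1), (fun x u v =>
    if excluded_middle_informative (x < 1 / 2) then star 2 u v else star 0 u v).
  split; [apply weight_one|]. split; [split; [|split]|].
  - intros u v _ _. apply meas01_two_valued, borel_lt.
  - intros x u v _ _ _. assert (0 < / sqrt 2) by (apply Rinv_0_lt_compat; lra).
    unfold star. destruct (excluded_middle_informative _);
      repeat match goal with |- context [Nat.eqb ?i ?j] => destruct (Nat.eqb i j) end; lra.
  (* Near-tangent branches have cosines at most 1 + 3/10 apart, below the 3/2 that separates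
     neighbours on the same half circle. *)
  - exists (/ 10), (/ 10). split; [lra|]. split; [lra|]. intros x u v Hx Hin.
    assert (Hw := Hin). destruct Hw as [Hu [Hv _]]. apply (proj1 (isword_1 _ _)) in Hu, Hv.
    apply inE_cos in Hin; [|lia | auto].
    assert (Hr : gamma / (INR 3 - gamma) <= / 2).
    { replace (INR 3) with 3 by (simpl; ring). apply Rle_div_l; lra. }
    replace (/ 10 * INR 3) with (3 / 10) in Hin by (simpl; lra).
    assert (G : forall l, (l < 2)%nat ->
      x + INR (Datatypes.S l) <= INR 3 / 2 \/ INR 3 / 2 <= x + INR l ->
      3 / 2 <= Rabs (cosw 3 x l - cosw 3 x (Datatypes.S l))).
    { intros l Hl Hs.
      destruct (half_circle_gap 3 l (Datatypes.S l) x) as [_ K]; [lia | lra | lia | auto|].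
      replace (Datatypes.S l - l)%nat with 1%nat in K by lia.
      replace (INR 3) with 3 in K by (simpl; ring).
      replace (INR 1) with 1 in K by reflexivity. rewrite sin_PI_div_3_sqr in K. lra. }
    assert (I : sqrt 2 * / sqrt 2 = 1) by (field; lra).
    assert (I' : / sqrt 2 * sqrt 2 = 1) by (field; lra).
    destruct (excluded_middle_informative (x < 1 / 2)) as [c|c].
    + assert (G0 := G 0%nat ltac:(lia) ltac:(left; simpl; lra)).
      destruct u as [|[|[|u]]]; [| | | lia]; (destruct v as [|[|[|v]]]; [| | | lia]);
        unfold star; cbn [Nat.eqb]; try lra.
      rewrite Rabs_minus_sym in G0; lra.
    + assert (G1 := G 1%nat ltac:(lia) ltac:(right; simpl; lra)).
      destruct u as [|[|[|u]]]; [| | | lia]; (destruct v as [|[|[|v]]]; [| | | lia]);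
        unfold star; cbn [Nat.eqb]; try lra.
      rewrite Rabs_minus_sym in G1; lra.
  - apply ess_le_of_le. intros x Hx. apply Sig_one_le; [lia|]. intros u Hu.
    rewrite Nat.pow_1_r in *.
    destruct (excluded_middle_informative (x < 1 / 2));
      apply Req_le; [apply (star_sum 2 u) | apply (star_sum 0 u)]; auto; lia.
Qed.

(** * The case gamma b <= 2 and the comparison with gamma b *)

(** Near tangency is confined to the diagonal, so two different partners of [k] would both equal
    [k]. *)
Lemma e_le_1 (b m : nat) (gamma : R) : (6 <= b)%nat -> / INR b < gamma < 1 ->
  gamma * INR b <= 2 -> e b gamma 1 = INR m -> (m <= 1)%nat.
Proof.
  intros hb Hg Hgb Em.
  destruct (inE_diagonal b gamma hb Hg Hgb) as [eps [He H]].
  destruct (e_eventually b gamma 1 ltac:(lia)) as [m' [N [Em' HN]]].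
  rewrite Em in Em'. apply INR_eq in Em'. subst m'.
  rewrite <- (HN N (le_n N)). apply nmax_le. intros j _. apply nmax_le. intros k _.
  match goal with |- (?c <= 1)%nat => destruct (le_lt_dec c 1) as [h|h]; auto end.
  destruct (ncount_spread _ _ _ h) as [l [l' [_ [[_ [_ K]] [[_ [_ K']] HD]]]]].
  destruct (K eps eps He He) as [x [_ Ex]]. destruct (K' eps eps He He) as [y [_ Ey]].
  apply H in Ex, Ey. lia.
Qed.

Theorem theorem3p1 (b : nat) (gamma : R)
  (hb : (2 <= b)%nat) (hg1 : / INR b < gamma) (hg2 : gamma < 1) :
  ((6 <= b)%nat ->
     sigma_le b gamma 1 (e b gamma 1) /\ e b gamma 1 < gamma * INR b) /\
  ((b = 4%nat \/ b = 5%nat) ->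
     e b gamma 1 = 2 \/ e b gamma 1 < gamma * INR b) /\
  (b = 3%nat ->
     e b gamma 1 = 2 \/ sigma_lt b gamma 1 (gamma * INR b)).
Proof.
  assert (B : 2 <= INR b) by (apply (le_INR 2); auto).
  assert (G0 : 0 < gamma) by (assert (0 < / INR b) by (apply Rinv_0_lt_compat; lra); lra).
  assert (G1 : 1 < gamma * INR b).
  { apply Rmult_lt_compat_r with (r := INR b) in hg1; [|lra]. rewrite Rinv_l in hg1; lra. }
  assert (S1 := sigma_le_e b gamma 1 hb).
  destruct (e_eventually b gamma 1 hb) as [m [_ [Em _]]].
  assert (Small : (m <= 1)%nat -> e b gamma 1 < gamma * INR b).
  { intros h. apply le_INR in h. simpl in h. lra. }
  (* If [e] is at least gamma b, then [e_le_2] gives [m <= 2]; and [m <= 1] is already below gamma b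
     > 1. *)
  assert (Main : (4 <= b)%nat -> e b gamma 1 < gamma * INR b \/ m = 2%nat).
  { intros h. destruct (Rlt_le_dec (e b gamma 1) (gamma * INR b)) as [|hm]; auto.
    rewrite Em in hm. assert (h' := e_le_2 b m gamma h ltac:(lra) Em hm).
    destruct (le_lt_dec m 1); [left; auto | right; lia]. }
  split; [|split].
  - intros hb6. split; auto.
    destruct (Main ltac:(lia)) as [|h2]; auto.
    (* Here [m = 2], so failure of the strict bound means gamma b <= 2, where [e_le_1] gives
       [m <= 1]. *)
    destruct (Rlt_le_dec (e b gamma 1) (gamma * INR b)) as [|hm]; auto.
    assert (E2 : INR m = 2) by (subst m; simpl; ring).
    assert (h := e_le_1 b m gamma hb6 ltac:(lra) ltac:(lra) Em). lia.
  - intros hb45. destruct (Main ltac:(lia)) as [|h2]; auto.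
    left. rewrite Em, h2. simpl; ring.
  (* For [m <= 1] the bound sigma(1) <= e(1) suffices; for [m >= 3] the star weights give 1 + sqrt 2
     < 3 gamma. *)
  - intros hb3. destruct (le_lt_dec m 1) as [h|h].
    + right. apply (sigma_lt_of_le _ _ _ _ _ S1); auto.
    + destruct (Nat.eq_dec m 2) as [->|N]; [left; rewrite Em; simpl; ring|].
      right. subst b.
      exists (1 + sqrt 2). split; [|apply sigma_3; lra].
      assert (K := e_3_gamma m gamma ltac:(lra) Em ltac:(lia)). simpl (INR 3). lra.
Qed.
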